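(* Let $G(1;x,y,p,q)=\sum_{\nu}x^{v(\nu)}y^{h(\nu)}p^{B(\nu)}q^{U(\nu)}$, summed over all convex polyominoes $\nu$, and let \[ u_\pm=1+\frac{(p+q)x\pm\sqrt{(p-q)^2x^2+4x}}{2(1-pqx)}. \] Then $G(1;x,y,p,q)$ equals \begin{align*} &\frac{y(y-1)(1-u_+)(1-u_-)}{(1-yu_+)(1-yu_-)}\\ &+\frac{y^2(1-u_+)(1-u_-)}{u_+-u_-}\left(\frac{u_+^2(1-u_+)G^{bt}(u_+;x,y,p,q)}{(1-yu_+)^2}-\frac{u_-^2(1-u_-)G^{bt}(u_-;x,y,p,q)}{(1-yu_-)^2}\right)\\ &-\frac{yu_+(1-u_+)(1-u_-)}{(u_+-u_-)(1-yu_+)}\Bigl((1-p(1-u_+))G^t(u_+;x,y,p,q)+(1-q(1-u_+))G^t(u_+;x,y,q,p)\Bigr)\\ &+\frac{yu_-(1-u_+)(1-u_-)}{(u_+-u_-)(1-yu_-)}\Bigl((1-p(1-u_-))G^t(u_-;x,y,p,q)+(1-q(1-u_-))G^t(u_-;x,y,q,p)\Bigr)\\ &+\frac{y(1-u_+)(1-u_-)}{(1-yu_+)(1-yu_-)}\bigl(G^t(1;x,y,p,q)+G^t(1;x,y,q,p)\bigr). \end{align*}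
   Context: A cell is a unit square of the square lattice; a polyomino is a finite nonempty edge-connected set of cells, considered up to translation. A polyomino is convex if each column and each row is a contiguous block of cells. For a convex polyomino $\nu$ with $m$ columns numbered $1,\dots,m$ from left to right, let $b_j(\nu)$ (resp. $u_j(\nu)$) be the height of the bottom edge of the lowest cell (resp. the top edge of the highest cell) of column $j$. $B(\nu)=|\{1\le j\le m-1:b_j=b_{j+1}\}|$, $U(\nu)=|\{1\le j\le m-1:u_j=u_{j+1}\}|$, $v(\nu)=m$ is the number of columns, $h(\nu)$ the number of rows, and $a(\nu)$ the number of cells of the leftmost column. $\mathcal{CP}^t$ is the set of convex polyominoes with $u_s(\nu)\le u_j(\nu)$ for all $j<s$; $\mathcal{CP}^b$ those with $b_s(\nu)\ge b_j(\nu)$ for all $j<s$; $\mathcal{CP}^{bt}=\mathcal{CP}^t\cap\mathcal{CP}^b$. Define $G^{bt}(u;x,y,p,q)=\sum_{\nu\in\mathcal{CP}^{bt}}x^{v(\nu)}y^{h(\nu)}p^{B(\nu)}q^{U(\nu)}u^{a(\nu)-1}$ and $G^{t}(u;x,y,p,q)=\sum_{\nu\in\mathcal{CP}^{t}}x^{v(\nu)}y^{h(\nu)}p^{B(\nu)}q^{U(\nu)}u^{a(\nu)-1}$; $G^t(u;x,y,q,p)$ denotes the same series with the roles of $p$ and $q$ interchanged. Here $u_\pm$ are formal power series in $\sqrt{x}$ and are substituted for $u$ formally. *)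

(* Defs.v *)
From HB Require Import structures.
From mathcomp Require Import all_boot all_order all_algebra.
From mathcomp Require Import boolp.

Set Implicit Arguments.
Unset Strict Implicit.
Unset Printing Implicit Defensive.

Import GRing.Theory.
Local Open Scope ring_scope.

Record fps (R : Type) := Fps { fps_coef : nat -> R }.
Coercion fps_coef : fps >-> Funclass.

HB.instance Definition _ (R : Type) := gen_eqMixin (fps R).
HB.instance Definition _ (R : Type) := gen_choiceMixin (fps R).

Lemma fpsP (R : Type) (f g : fps R) : f =1 g -> f = g.
Proof. by case: f g => [f] [g] /= fg; congr Fps; apply/funext. Qed.

Section Zmodule.
Variable R : zmodType.
Implicit Types f g h : fps R.

Definition fps_zero : fps R := Fps (fun=> 0).
Definition fps_opp f := Fps (fun n => - f n).
Definition fps_add f g := Fps (fun n => f n + g n).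

Fact fps_addA : associative fps_add.
Proof. by move=> f g h; apply: fpsP => n /=; rewrite addrA. Qed.
Fact fps_addC : commutative fps_add.
Proof. by move=> f g; apply: fpsP => n /=; rewrite addrC. Qed.
Fact fps_add0 : left_id fps_zero fps_add.
Proof. by move=> f; apply: fpsP => n /=; rewrite add0r. Qed.
Fact fps_addN : left_inverse fps_zero fps_opp fps_add.
Proof. by move=> f; apply: fpsP => n /=; rewrite addNr. Qed.

HB.instance Definition _ := GRing.isZmodule.Build (fps R)
  fps_addA fps_addC fps_add0 fps_addN.

Lemma fps_coef0 n : (0 : fps R) n = 0. Proof. by []. Qed.
Lemma fps_coefN f n : (- f) n = - f n. Proof. by []. Qed.
Lemma fps_coefD f g n : (f + g) n = f n + g n. Proof. by []. Qed.
Lemma fps_coefB f g n : (f - g) n = f n - g n. Proof. by []. Qed.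

(* The limit of the iterates of F, meaningful when the coefficient of index n *)
(* of F f depends only on the coefficients of f of index less than n.         *)
Definition fps_fix (F : fps R -> fps R) : fps R :=
  Fps (fun n => iter n.+1 F 0 n).

Lemma fps_fixE (F : fps R -> fps R) :
    (forall n f g, (forall i, (i < n)%N -> f i = g i) -> F f n = F g n) ->
  F (fps_fix F) = fps_fix F.
Proof.
move=> Fc.
have agree k d i : (i < k)%N -> iter (d + k) F 0 i = iter k F 0 i.
  elim: k i => [//|k IHk] i; rewrite ltnS addnS !iterS => le_ik.
  by apply: Fc => j lt_ji; apply: IHk; apply: leq_trans le_ik.
apply: fpsP => n; rewrite /fps_fix /=; apply: Fc => i lt_in /=.
by rewrite -iterS -(subnK lt_in) agree.
Qed.

(* The sum of the F m, provided that F m has order at least m: only the terms *)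
(* of index at most n then contribute to the coefficient of index n.          *)
Definition fps_sum (F : nat -> fps R) : fps R :=
  Fps (fun n => \sum_(m < n.+1) F m n).

End Zmodule.

Section Ring.
Variable R : comNzRingType.
Implicit Types f g h : fps R.

Definition fpsC (c : R) : fps R := Fps (fun n => if n == 0%N then c else 0).
Definition fpsX : fps R := Fps (fun n => (n == 1%N)%:R).
Definition fps_mul f g := Fps (fun n => \sum_(i < n.+1) f i * g (n - i)%N).

Definition fps_trunc (n : nat) f : {poly R} := \poly_(i < n.+1) f i.

Lemma coef_fps_trunc n f i : (i <= n)%N -> (fps_trunc n f)`_i = f i.
Proof. by move=> le_in; rewrite coef_poly ltnS le_in. Qed.

Lemma fps_mul_trunc n f g i : (i <= n)%N ->
  fps_mul f g i = (fps_trunc n f * fps_trunc n g)`_i.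
Proof.
move=> le_in; rewrite coefM /=; apply: eq_bigr => j _.
rewrite !coef_fps_trunc //; first exact: leq_trans (leq_subr _ _) le_in.
by apply: leq_trans le_in; rewrite -ltnS.
Qed.

Fact fps_mulA : associative fps_mul.
Proof.
move=> f g h; apply: fpsP => n.
have aux (a b c : fps R) :
    fps_mul a (fps_mul b c) n
    = (fps_trunc n a * (fps_trunc n b * fps_trunc n c))`_n.
  rewrite coefM; apply: eq_bigr => i _.
  rewrite (@fps_mul_trunc n) ?leq_subr // coef_fps_trunc //.
  by rewrite -ltnS.
have fps_mulC' (a b : fps R) : fps_mul a b n = fps_mul b a n.
  by rewrite !(@fps_mul_trunc n) // mulrC.
by rewrite [RHS]fps_mulC' !aux mulrA mulrC.
Qed.

Fact fps_mulC : commutative fps_mul.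
Proof. by move=> f g; apply: fpsP => n; rewrite !(@fps_mul_trunc n) // mulrC. Qed.

Fact fps_mul1 : left_id (fpsC 1) fps_mul.
Proof.
move=> f; apply: fpsP => n /=; rewrite big_ord_recl /= mul1r subn0.
by rewrite big1 ?addr0 // => i _; rewrite mul0r.
Qed.

Fact fps_mulDl : left_distributive fps_mul (@fps_add R).
Proof.
move=> f g h; apply: fpsP => n /=; rewrite -big_split /=.
by apply: eq_bigr => i _; rewrite mulrDl.
Qed.

Fact fps_oner_neq0 : fpsC 1 != 0.
Proof. by apply/eqP => /(congr1 (@fps_coef R)) /(congr1 (@^~ 0%N)) /eqP; rewrite oner_eq0. Qed.

HB.instance Definition _ := GRing.Zmodule_isComNzRing.Build (fps R)
  fps_mulA fps_mulC fps_mul1 fps_mulDl fps_oner_neq0.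

Lemma fps_coef1 n : (1 : fps R) n = (n == 0%N)%:R.
Proof. by rewrite /GRing.one /=; case: eqP. Qed.

Lemma fps_coefM f g n : (f * g) n = \sum_(i < n.+1) f i * g (n - i)%N.
Proof. by []. Qed.

Fact fpsC_is_zmod_morphism : zmod_morphism fpsC.
Proof. by move=> c d; apply: fpsP => -[|n] /=; rewrite ?subrr. Qed.
HB.instance Definition _ :=
  GRing.isZmodMorphism.Build R (fps R) fpsC fpsC_is_zmod_morphism.

Fact fpsC_is_monoid_morphism : monoid_morphism fpsC.
Proof.
split=> // c d; apply: fpsP => n.
rewrite fps_coefM big_ord_recl subn0 /= big1 ?addr0 => [|i _]; last first.
  by rewrite mul0r.
by case: n => [|n] //=; rewrite mulr0.
Qed.
HB.instance Definition _ :=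
  GRing.isMonoidMorphism.Build R (fps R) fpsC fpsC_is_monoid_morphism.

End Ring.

Section UnitRing.
Variable R : comUnitRingType.
Implicit Types f g : fps R.

Definition fps_unit : pred (fps R) := fun f => f 0%N \is a GRing.unit.

Definition fps_inv_step f g : fps R := Fps (fun n =>
  (f 0%N)^-1 * ((n == 0%N)%:R - \sum_(i < n) f i.+1 * g (n - i.+1)%N)).
Definition fps_inv f : fps R :=
  if fps_unit f then fps_fix (fps_inv_step f) else f.

Fact fps_mulV : {in fps_unit, left_inverse 1 fps_inv *%R}.
Proof.
move=> f fU; have f0U : f 0%N \is a GRing.unit by [].
rewrite /fps_inv ifT //.
have: fps_inv_step f (fps_fix (fps_inv_step f)) = fps_fix (fps_inv_step f).
  apply: fps_fixE => n g h gh; rewrite /fps_inv_step /=; congr (_ * (_ - _)).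
  by apply: eq_bigr => i _; rewrite gh // ltn_subrL (leq_trans _ (ltn_ord i)).
move: (fps_fix _) => g gE; apply: fpsP => n; rewrite mulrC fps_coefM fps_coef1.
by rewrite big_ord_recl subn0 -{1}gE /= mulrA divrr // mul1r subrK.
Qed.

Fact fps_unitPl f g : g * f = 1 -> fps_unit f.
Proof.
move=> /(congr1 (fun h : fps R => h 0%N)).
rewrite fps_coefM big_ord1 fps_coef1 /= => gf.
by apply/unitrPr; exists (g 0%N); rewrite mulrC.
Qed.

Fact fps_invr_out : {in [predC fps_unit], fps_inv =1 id}.
Proof. by move=> f fU; rewrite /fps_inv ifN. Qed.

HB.instance Definition _ := GRing.ComNzRing_hasMulInverse.Build (fps R)
  fps_mulV fps_unitPl fps_invr_out.

Lemma fps_unitE f : (f \is a GRing.unit) = (f 0%N \is a GRing.unit).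
Proof. by []. Qed.

(* The square root with constant coefficient 1 of a series with constant      *)
(* coefficient 1.                                                             *)
Definition fps_sqrt_step f g : fps R := Fps (fun n =>
  if n is n'.+1
  then (f n - \sum_(i < n') g i.+1 * g (n' - i)%N) / 2%:R else 1).
Definition fps_sqrt f : fps R := fps_fix (fps_sqrt_step f).

Lemma sqr_fps_sqrt f : (2%:R : R) \is a GRing.unit -> f 0%N = 1 ->
  fps_sqrt f ^+ 2 = f.
Proof.
move=> U2 f0.
have: fps_sqrt_step f (fps_sqrt f) = fps_sqrt f.
  apply: fps_fixE => -[|n] g h gh //=; congr ((_ - _) / _).
  apply: eq_bigr => i _; rewrite !gh // ltnS ?leq_subr //.
move: (fps_sqrt f) => g gE; apply: fpsP => n; rewrite expr2 fps_coefM.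
have g0 : g 0%N = 1 by rewrite -gE.
case: n => [|n]; first by rewrite big_ord1 subnn g0 mulr1.
rewrite big_ord_recl big_ord_recr /= subn0 subnn g0 mul1r mulr1.
have gS : g n.+1 * 2%:R = f n.+1 - \sum_(i < n) g i.+1 * g (n - i)%N.
  by rewrite -{1}gE /= divrK.
rewrite addrCA -mulr2n -mulr_natr gS.
by under eq_bigr do rewrite subSS; rewrite subrKC.
Qed.

End UnitRing.

Section IntegralDomain.
Variable R : idomainType.

Fact fps_integral (f g : fps R) : f * g = 0 -> (f == 0) || (g == 0).
Proof.
have low (h : fps R) : h != 0 ->
    exists n, h n != 0 /\ forall i, (i < n)%N -> h i = 0.
  move=> h0; have [n hn] : exists n, h n != 0.
    apply: contra_notP (elimN eqP h0) => /forallNP h0'; apply: fpsP => n.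
    by apply/eqP/negPn/negP; apply: h0'.
  have ex : exists n, h n != 0 by exists n.
  exists (ex_minn ex); case: ex_minnP => m hm min_m; split=> // i lt_im.
  by apply: contraTeq lt_im => /min_m; rewrite -leqNgt.
move=> fg0; apply: contraT; rewrite negb_or => /andP[/low[a [fa fa0]]].
move=> /low[b [gb gb0]].
have /eqP := congr1 (fun h : fps R => h (a + b)%N) fg0.
have lt_a : (a < (a + b).+1)%N by rewrite ltnS leq_addr.
rewrite fps_coefM (bigD1 (Ordinal lt_a)) //= addKn big1 ?addr0.
  by rewrite mulf_eq0 (negbTE fa) (negbTE gb).
move=> i; rewrite -val_eqE /= neq_ltn => /orP[lt_ia|lt_ai].
  by rewrite fa0 ?mul0r.
by rewrite gb0 ?mulr0 // ltn_subLR ?ltn_add2r // -ltnS.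
Qed.

HB.instance Definition _ :=
  GRing.ComUnitRing_isIntegral.Build (fps R) fps_integral.

End IntegralDomain.

(* A translation class of polyominoes with m columns and h rows is represented *)
(* by its unique member that lies in the box [0, m) x [0, h), which it touches *)
(* in every column and in every row. The pair (j, k) is the cell of column j   *)
(* whose bottom edge has height k and whose top edge has height k + 1; columns *)
(* are thus numbered from 0.                                                   *)
Section Polyomino.
Variables m h : nat.
Implicit Types (c d : 'I_m * 'I_h) (A : {set 'I_m * 'I_h}).

Definition edge_adjacent : rel ('I_m * 'I_h) := fun c d =>
  ((c.1 == d.1) && ((c.2.+1 == d.2 :> nat) || (d.2.+1 == c.2 :> nat)))
  || ((c.2 == d.2) && ((c.1.+1 == d.1 :> nat) || (d.1.+1 == c.1 :> nat))).

Definition edge_connected A : bool :=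
  [forall c in A, forall d in A,
     connect [rel c' d' | [&& c' \in A, d' \in A & edge_adjacent c' d']] c d].

Definition spans_box A : bool :=
  [forall j : 'I_m, exists k : 'I_h, (j, k) \in A]
  && [forall k : 'I_h, exists j : 'I_m, (j, k) \in A].

Definition polyomino A : bool :=
  [&& A != set0, edge_connected A & spans_box A].

Definition column_convex A : bool :=
  [forall j : 'I_m, forall k1 : 'I_h, forall k : 'I_h, forall k2 : 'I_h,
     [&& (j, k1) \in A, (j, k2) \in A, (k1 <= k)%N & (k <= k2)%N]
       ==> ((j, k) \in A)].

Definition row_convex A : bool :=
  [forall k : 'I_h, forall j1 : 'I_m, forall j : 'I_m, forall j2 : 'I_m,
     [&& (j1, k) \in A, (j2, k) \in A, (j1 <= j)%N & (j <= j2)%N]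
       ==> ((j, k) \in A)].

Definition CP A : bool := [&& polyomino A, column_convex A & row_convex A].

Definition bottom A (j : nat) : nat :=
  \big[minn/h]_(c in A | c.1 == j :> nat) c.2.
Definition top A (j : nat) : nat :=
  \max_(c in A | c.1 == j :> nat) c.2.+1.

Definition statB A : nat :=
  #|[set j : 'I_m.-1 | bottom A j == bottom A j.+1]|.
Definition statU A : nat :=
  #|[set j : 'I_m.-1 | top A j == top A j.+1]|.
Definition stata A : nat := #|[set c in A | c.1 == 0%N :> nat]|.

Definition CPt A : bool :=
  CP A && [forall s : 'I_m, forall j : 'I_m, (j < s)%N ==> (top A s <= top A j)%N].
Definition CPb A : bool :=
  CP A && [forall s : 'I_m, forall j : 'I_m,
             (j < s)%N ==> (bottom A j <= bottom A s)%N].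
Definition CPbt A : bool := CPt A && CPb A.

End Polyomino.

(* The polynomial ring Q[p, q], the series over it in the variable sqrt x, the *)
(* series over these in y, and the fraction field of the last ring, in which   *)
(* u_+ - u_- is invertible although it has no constant coefficient.            *)
Notation Qpq := {poly {poly rat}}.
Notation Qpq_x := (fps Qpq).
Notation Qpq_xy := (fps Qpq_x).
Notation Qpq_xy_frac := {fraction Qpq_xy}.

Definition p_ : Qpq := 'X%:P.
Definition q_ : Qpq := 'X.
Definition x_ : Qpq_x := fpsX Qpq ^+ 2.
Definition y_ : Qpq_xy := fpsX Qpq_x.

(* The sum over the family S of polyominoes of                                 *)
(*   x^v(nu) y^h(nu) p^B(nu) q^U(nu) u^(a(nu)-1).                              *)
(* The coefficient of y^h is a series over the number m of columns, in which   *)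
(* the term of index m is divisible by x^m, as fps_sum requires; for given m   *)
(* and h there are finitely many polyominoes.                                  *)
Definition genfun (S : forall m h : nat, pred {set 'I_m * 'I_h})
    (u : Qpq_x) (p q : Qpq) : Qpq_xy :=
  Fps (fun h => fps_sum (fun m =>
    x_ ^+ m * \sum_(A : {set 'I_m * 'I_h} | S m h A)
      fpsC (p ^+ statB A * q ^+ statU A) * u ^+ (stata A).-1)).

(* The square root of (p - q)^2 x^2 + 4 x with coefficient 2 at sqrt x.        *)
Definition sqrt_disc : Qpq_x :=
  2%:R * fpsX Qpq
  * fps_sqrt (1 + fpsC ((p_ - q_) ^+ 2 / 4%:R) * x_).

Lemma unit_nat_Qpq (n : nat) : (n.+1%:R : Qpq) \is a GRing.unit.
Proof.
have -> : n.+1%:R = n.+1%:R%:P%:P :> Qpq by rewrite !rmorph_nat.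
by rewrite !rmorph_unit // unitfE Num.Theory.pnatr_eq0.
Qed.

Lemma x_coef0 : x_ 0%N = 0.
Proof. by rewrite /x_ expr2 fps_coefM big_ord1 /= mul0r. Qed.

Lemma sqr_sqrt_disc :
  sqrt_disc ^+ 2 = fpsC (p_ - q_) ^+ 2 * x_ ^+ 2 + 4%:R * x_.
Proof.
rewrite /sqrt_disc !exprMn sqr_fps_sqrt ?(unit_nat_Qpq 1) //; last first.
  by rewrite fps_coefD fps_coefM big_ord1 x_coef0 mulr0 addr0.
have E4 : 4%:R * fpsC (4%:R^-1 : Qpq) = 1.
  by rewrite -(rmorph_nat (@fpsC Qpq) 4) -rmorphM mulrV ?unit_nat_Qpq ?rmorph1.
rewrite -/x_ rmorphM rmorphXn /= -natrX mulrDr mulr1 addrC.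
congr (_ + _); move: (fpsC _ ^+ 2) => d.
by rewrite mulrACA [d * _]mulrC (mulrA _ _ d) E4 mul1r.
Qed.

Lemma unit_u_denominator : 2%:R * (1 - fpsC (p_ * q_) * x_) \is a GRing.unit.
Proof.
rewrite unitrM !fps_unitE fps_coefB fps_coefM big_ord1 x_coef0 mulr0 subr0.
by rewrite unitr1 andbT (unit_nat_Qpq 1).
Qed.

Definition u_plus : Qpq_x :=
  1 + (fpsC (p_ + q_) * x_ + sqrt_disc) / (2%:R * (1 - fpsC (p_ * q_) * x_)).
Definition u_minus : Qpq_x :=
  1 + (fpsC (p_ + q_) * x_ - sqrt_disc) / (2%:R * (1 - fpsC (p_ * q_) * x_)).

Definition frac_of_xy (f : Qpq_xy) : Qpq_xy_frac := tofrac f.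
Definition frac_of_x (f : Qpq_x) : Qpq_xy_frac := tofrac (fpsC f).
Definition frac_of_pq (c : Qpq) : Qpq_xy_frac := tofrac (fpsC (fpsC c)).

(* Main.v *)
(* The leftmost column is removed: a column added to the left of a convex     *)
(* polyomino either stays within the rows of the former first column, or      *)
(* overhangs above it (allowed exactly on CP^t), below it (exactly on CP^b,   *)
(* the mirror image of CP^t) or on both sides (CP^bt). With v = 1 - u this    *)
(* gives a linear equation                                                    *)
(*   (v^2 - x (pq v^2 - (p + q) v + 1)) G(u) = terms in G(1), G'(1), G^t, G^bt *)
(* whose kernel vanishes exactly at u = u_+ and u = u_-. The two resulting    *)
(* equations are linear in G(1) and G'(1); eliminating G'(1) gives G(1).      *)

Require Import Defs.
From HB Require Import structures.
From mathcomp Require Import all_boot all_order all_algebra.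
From mathcomp Require Import zify ring.

Set Implicit Arguments.
Unset Strict Implicit.
Unset Printing Implicit Defensive.

Import GRing.Theory.
Local Open Scope ring_scope.

(** * Convex polyominoes as sequences of columns *)

(** Record a convex polyomino by its columns, read from left to right as intervals. Connectedness
    says that neighbouring intervals overlap, and row convexity becomes a condition on the first two
    columns and the extremes of the tail: a column may leave the rows of its right neighbour upwards
    only if that neighbour attains the maximal top of the tail, and downwards only if it attains the
    minimal bottom. This is a bijection with sequences of columns ([perm_cols]), under which CP^t
    and CP^b are the sequences whose first column attains the extreme top or bottom.

    Adding a column on the left therefore splits into four cases, according to whether it extends
    the box upwards and whether it extends it downwards ([colsum_step]). Summing u^(height-1) over
    the positions of the new column produces geometric sums with denominators v = 1 - u and v^2; an
    overhang by j contributes u^j y^j, hence the factor [geo u] = uy/(1 - uy). Multiplying by v^2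
    and summing over the number of columns gives [functional_equation]. Reflection in a horizontal
    line ([colsum_flip]) turns the series of CP^b into G^t with p and q exchanged.

    If v^2 = x (pq v^2 - (p+q) v + 1), the series G(u) cancels ([kernel_equation]), and both u_+ and
    u_- satisfy this relation ([kernel_root]). The two resulting equations are linear in G(1) and
    G'(1); [elimination] solves them for G(1) in the fraction field. *)

Section ColumnSequences.
Local Open Scope nat_scope.

(* The pair (b, t) is the column with bottom edge b and top edge t. *)
Definition column := (nat * nat)%type.
Implicit Types (c d : column) (s : seq column).

(** A one-column sequence is a separate case because the default value 0 of the empty sequence would
    otherwise absorb every minimum. *)
Fixpoint lo s :=
  if s is c :: s' then if s' is [::] then c.1 else minn c.1 (lo s') else 0.
Fixpoint hi s := if s is c :: s' then maxn c.2 (hi s') else 0.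

(* Row convexity when c is put to the left of s, whose first column is d: if c *)
(* leaves the rows of d downwards (upwards), then no column of s may reach     *)
(* below (above) d.                                                            *)
Definition attaches c d s :=
  [&& c.1 < d.2, d.1 < c.2,
      (d.1 <= c.1) || (d.1 == lo s) & (c.2 <= d.2) || (d.2 == hi s)].

Fixpoint convex s :=
  if s is c :: s' then
    (c.1 < c.2) && (if s' is d :: _ then attaches c d s' && convex s' else true)
  else false.

Fixpoint flats (f : column -> nat) s :=
  if s is c :: s' then
    (if s' is d :: _ then (f c == f d) : nat else 0) + flats f s'
  else 0.

Definition top_first s := (head (0, 0) s).2 == hi s.
Definition bottom_first s := (head (0, 0) s).1 == lo s.
Definition height s := (head (0, 0) s).2 - (head (0, 0) s).1.
Definition boxed l r s := [&& convex s, lo s == l & hi s == r].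

(* The bound N on the heights only serves to make the enumeration finite. *)
Definition columns N : seq column :=
  [seq (b, t) | b <- index_iota 0 N.+1, t <- index_iota 0 N.+1].
#[global] Arguments columns : simpl never.
Fixpoint col_seqs N m : seq (seq column) :=
  if m is m'.+1 then [seq c :: s | c <- columns N, s <- col_seqs N m']
  else [:: [::]].

#[global] Arguments col_seqs : simpl never.

Lemma mem_columns N c : (c \in columns N) = (c.1 <= N) && (c.2 <= N).
Proof.
apply/allpairsP/andP => [[[b t] [bN tN ->]]|[cb ct]].
  by move: bN tN; rewrite !mem_index_iota !ltnS.
by exists c; rewrite !mem_index_iota !ltnS -surjective_pairing.
Qed.

Lemma col_seqsS N m :
  col_seqs N m.+1 = [seq c :: s | c <- columns N, s <- col_seqs N m].
Proof. by []. Qed.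

Lemma mem_col_seqs N m s :
  (s \in col_seqs N m) = (size s == m) && all (mem (columns N)) s.
Proof.
elim: m s => [|m IHm] [|c s] //; rewrite col_seqsS.
  by apply/negbTE/negP=> /allpairsP[[? ?]] [].
rewrite [RHS]/=; apply/allpairsP/idP => [[[d t] /= [dN tm [-> ->]]]|].
  by rewrite eqSS dN andTb -IHm.
by rewrite eqSS andbCA -IHm => /andP[cN sm]; exists (c, s).
Qed.

Lemma uniq_col_seqs N m : uniq (col_seqs N m).
Proof.
elim: m => [|m IHm] //; rewrite col_seqsS; apply: allpairs_uniq => //.
  by apply: allpairs_uniq => [| |[? ?] [? ?] _ _ []]; rewrite ?iota_uniq // => -> ->.
by move=> [c s] [d t] _ _ [-> ->].
Qed.

Lemma lo_cons c s : s != [::] -> lo (c :: s) = minn c.1 (lo s).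
Proof. by case: s. Qed.

Lemma hi_cons c s : hi (c :: s) = maxn c.2 (hi s).
Proof. by []. Qed.

Lemma convex_cons c d s : convex (c :: d :: s) =
  [&& c.1 < c.2, attaches c d (d :: s) & convex (d :: s)].
Proof. by []. Qed.

Lemma lo_head c s : lo (c :: s) <= c.1.
Proof. by case: s => //= d s; rewrite geq_minl. Qed.

Lemma hi_head c s : c.2 <= hi (c :: s).
Proof. by rewrite leq_maxl. Qed.

Lemma convex_bounds s : convex s ->
  [/\ lo s <= (head (0, 0) s).1, (head (0, 0) s).1 < (head (0, 0) s).2
    & (head (0, 0) s).2 <= hi s].
Proof.
case: s => // c s cs; split; [exact: lo_head| |exact: hi_head].
by move: cs => /= /andP[].
Qed.

Lemma hi_col_seqs N m s : s \in col_seqs N m -> hi s <= N.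
Proof.
rewrite mem_col_seqs => /andP[_]; elim: s => //= c s IHs /andP[].
by rewrite mem_columns geq_max => /andP[_ ->] /IHs.
Qed.

Lemma ltn_lo_hi s : convex s -> lo s < hi s.
Proof. by move=> /convex_bounds[]; lia. Qed.

Definition shift k s := [seq (c.1 + k, c.2 + k) | c : column <- s].

Lemma shift_cons k c s : shift k (c :: s) = (c.1 + k, c.2 + k) :: shift k s.
Proof. by []. Qed.

Lemma lo_shift k s : s != [::] -> lo (shift k s) = lo s + k.
Proof.
elim: s => // c [//|d s] IHs _.
by rewrite lo_cons // [RHS]/= -/(lo (d :: s)) addn_minl -IHs.
Qed.

Lemma hi_shift k s : s != [::] -> hi (shift k s) = hi s + k.
Proof.
elim: s => // c [|d s] IHs _; first by rewrite /= !maxn0.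
by rewrite shift_cons [LHS]hi_cons IHs // -addn_maxl.
Qed.

Lemma convex_shift k s : convex (shift k s) = convex s.
Proof.
elim: s => // c [|d s] IHs; first by rewrite /= ltn_add2r.
rewrite convex_cons -IHs 2!shift_cons convex_cons -!shift_cons.
by rewrite /attaches lo_shift // hi_shift // !leq_add2r !ltn_add2r !eqn_add2r.
Qed.

Lemma flats_shift k s :
  flats fst (shift k s) = flats fst s /\ flats snd (shift k s) = flats snd s.
Proof.
by elim: s => // c [|d s] [] //= -> ->; rewrite !eqn_add2r.
Qed.

Lemma height_shift k s : height (shift k s) = height s.
Proof. by case: s => //= c s; rewrite /height /= subnDr. Qed.

Lemma top_first_shift k s : s != [::] -> top_first (shift k s) = top_first s.
Proof.
move=> s0; rewrite /top_first hi_shift //.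
by case: s s0 => //= c s _; rewrite eqn_add2r.
Qed.

Lemma bottom_first_shift k s : s != [::] ->
  bottom_first (shift k s) = bottom_first s.
Proof.
move=> s0; rewrite /bottom_first lo_shift //.
by case: s s0 => //= c s _; rewrite eqn_add2r.
Qed.

Lemma lo_le s c : c \in s -> lo s <= c.1.
Proof.
elim: s => // d [|e s] IHs; first by rewrite inE => /eqP->.
by rewrite inE lo_cons // => /orP[/eqP->|/IHs]; rewrite geq_min ?leqnn // orbC => ->.
Qed.

Lemma hi_ge s c : c \in s -> c.2 <= hi s.
Proof.
elim: s => // d s IHs; rewrite inE => /orP[/eqP->|/IHs] /=; first exact: leq_maxl.
by rewrite leq_max orbC => ->.
Qed.

Lemma lo_ex s : s != [::] -> exists2 c, c \in s & c.1 = lo s.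
Proof.
elim: s => // d [|e s] IHs _; first by exists d; rewrite ?inE.
have [//|c cs cE] := IHs; rewrite lo_cons // /minn; case: ifP => _.
  by exists d; rewrite ?inE ?eqxx.
by exists c; rewrite // inE cs orbT.
Qed.

Lemma hi_ex s : s != [::] -> exists2 c, c \in s & c.2 = hi s.
Proof.
elim: s => // d [|e s] IHs _; first by exists d; rewrite ?inE //= maxn0.
have [//|c cs cE] := IHs; rewrite /= -/(hi (e :: s)) /maxn; case: ifP => _.
  by exists c; rewrite // inE cs orbT.
by exists d; rewrite ?inE ?eqxx.
Qed.

Lemma convex_lt s c : convex s -> c \in s -> c.1 < c.2.
Proof.
elim: s => // d [|e s] IHs.
  by rewrite /= andbT inE => dd /eqP->.
by move=> /andP[dd /andP[_ /IHs cs]]; rewrite inE => /orP[/eqP->|].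
Qed.

(** Every edge of a sequence boxed in [l, r) is at least l, so translation down by l loses nothing
    to truncated subtraction. Once r <= N the bound N excludes nothing, which allows a different
    bound on each side. *)
Lemma perm_shift N m l r (S : pred (seq column)) :
    r <= N -> (forall s, s != [::] -> S (shift l s) = S s) ->
  perm_eq [seq s <- col_seqs N m | boxed l r s && S s]
    (map (shift l) [seq s <- col_seqs (r - l) m | boxed 0 (r - l) s && S s]).
Proof.
move=> rN Sl; have shift_inj : injective (shift l).
  by apply: inj_map => -[a b] [c d] [/addIn-> /addIn->].
apply: uniq_perm; rewrite ?(map_inj_uniq shift_inj) ?filter_uniq ?uniq_col_seqs //.
move=> s; rewrite mem_filter; apply/idP/mapP.
  move=> /andP[/andP[/and3P[cs /eqP los /eqP his] Ss]].
  rewrite mem_col_seqs => /andP[sm _].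
  have s0 : s != [::] by case: (s) cs.
  pose t := [seq (c.1 - l, c.2 - l) | c <- s].
  have sE : s = shift l t.
    rewrite /shift -map_comp map_id_in // => c cs' /=.
    have := lo_le cs'; have := convex_lt cs cs'; rewrite los => ? ?.
    by rewrite !subnK; [case: (c)|lia|lia].
  have t0 : t != [::] by rewrite -size_eq0 size_map size_eq0.
  have lr : l < r by rewrite -los -his ltn_lo_hi.
  have lot : lo t = 0 by move: los; rewrite sE lo_shift //; lia.
  have hit : hi t = r - l by move: his; rewrite sE hi_shift //; lia.
  exists t => //; rewrite mem_filter mem_col_seqs size_map sm /boxed.
  rewrite -(convex_shift l) -sE cs lot hit !eqxx -Sl // -sE Ss /=.
  apply/allP=> c ct /=; rewrite mem_columns -hit hi_ge // andbT.
  have ctl : (c.1 + l, c.2 + l) \in s by rewrite sE; apply/mapP; exists c.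
  have := convex_lt cs ctl => /=; rewrite ltn_add2r => /ltnW/leq_trans; apply.
  exact: hi_ge.
move=> [t]; rewrite mem_filter => /andP[/andP[/and3P[ct /eqP lot /eqP hit] St]].
rewrite mem_col_seqs => /andP[tm _] ->.
have t0 : t != [::] by case: (t) ct.
have := ltn_lo_hi ct => ?.
rewrite /boxed convex_shift ct lo_shift // hi_shift // lot hit Sl // St.
rewrite mem_col_seqs size_map tm subnK ?eqxx /=; last by lia.
apply/allP=> c' /mapP[c ct' ->] /=; rewrite mem_columns /=.
by have := hi_ge ct'; have := convex_lt ct ct'; rewrite hit; lia.
Qed.

End ColumnSequences.

(** * Convexity of a sequence as a condition on its columns by index *)

Section ConvexProfile.
Local Open Scope nat_scope.
Implicit Types (c d : column) (s : seq column).

Definition bot s j := (nth (0, 0) s j).1.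
Definition upr s j := (nth (0, 0) s j).2.

Definition row_connected s := forall k i j l, i <= j <= l -> l < size s ->
  bot s i <= k < upr s i -> bot s l <= k < upr s l -> bot s j <= k < upr s j.

Definition overlapping s := forall j, j.+1 < size s ->
  bot s j < upr s j.+1 /\ bot s j.+1 < upr s j.

Lemma bot_ge_lo s j : j < size s -> lo s <= bot s j.
Proof. by move=> js; apply/lo_le/mem_nth. Qed.

Lemma upr_le_hi s j : j < size s -> upr s j <= hi s.
Proof. by move=> js; apply/hi_ge/mem_nth. Qed.

Lemma bot_lo s : s != [::] -> exists2 j, j < size s & bot s j = lo s.
Proof.
move=> /lo_ex[c cs <-]; exists (index c s); first by rewrite index_mem.
by rewrite /bot nth_index.
Qed.

Lemma upr_hi s : s != [::] -> exists2 j, j < size s & upr s j = hi s.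
Proof.
move=> /hi_ex[c cs <-]; exists (index c s); first by rewrite index_mem.
by rewrite /upr nth_index.
Qed.

Lemma convex_overlapping s : convex s -> overlapping s.
Proof.
elim: s => // c [|d s] IHs //; rewrite convex_cons => /and3P[cc att cs].
by case=> [|j] js; [case/and4P: att|exact: IHs].
Qed.

(** If the first column c and a later column both contain row k, so does the second column d: were k
    below d, then c would leave d downwards, d would attain the minimal bottom, and no later column
    could reach k; likewise above. Induction handles the rest. *)
Lemma convex_row_connected s : convex s -> row_connected s.
Proof.
elim: s => // c [|d s] IHs.
  by move=> _ k i j l ijl /= l1 ik _; have -> : j = i by lia.
rewrite convex_cons => /and3P[cc /and4P[_ _ bv tv] cs] k [|i] [|j] [|l] //=; rewrite ?andbF //.
  move=> jl ls; rewrite /bot /upr /= -/(bot (d :: s) l) -/(upr (d :: s) l).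
  rewrite -/(bot (d :: s) j) -/(upr (d :: s) j) => ck lk.
  apply: (IHs cs k 0 j l) => //; rewrite /bot /upr /=.
  have := @bot_ge_lo (d :: s) l ls; have := @upr_le_hi (d :: s) l ls.
  move: bv tv lk ck; lia.
by move=> ijl ls; apply: (IHs cs k i j l).
Qed.

Lemma row_connected_convex s : 0 < size s ->
    (forall j, j < size s -> bot s j < upr s j) ->
  overlapping s -> row_connected s -> convex s.
Proof.
elim: s => // c [|d s] IHs _ lt ov row.
  by rewrite /= andbT (lt 0).
rewrite convex_cons (lt 0) //=; apply/andP; split; last first.
  apply: IHs => // [j js|j js|k i j l ijl ls]; first exact: (lt j.+1).
    exact: (ov j.+1).
  exact: (row k i.+1 j.+1 l.+1).
have [cd dc] := ov 0 isT; rewrite /bot /upr /= in cd dc.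
rewrite /attaches cd dc !andTb.
have low l : c.1 < d.1 -> l < (size s).+1 -> d.1 <= bot (d :: s) l.
  move=> cd1; elim: l => // l IHl ls; rewrite leqNgt; apply/negP => lt_l.
  have {}IHl := IHl (ltnW ls); have [ov1 ov2] := ov l.+1 ls.
  (* The first later column to go below d overlaps its predecessor, which does not, so it contains
     the row just under d. So does c, and row convexity would put that row in d. *)
  have := row d.1.-1 0 1 l.+2 isT ls.
  rewrite /bot /upr /= in lt_l ov1 ov2 IHl *; lia.
have upp l : d.2 < c.2 -> l < (size s).+1 -> upr (d :: s) l <= d.2.
  move=> cd1; elim: l => // l IHl ls; rewrite leqNgt; apply/negP => lt_l.
  have {}IHl := IHl (ltnW ls); have [ov1 ov2] := ov l.+1 ls.
  have := row d.2 0 1 l.+2 isT ls.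
  rewrite /bot /upr /= in lt_l ov1 ov2 IHl *; lia.
apply/andP; split.
  have [//|cd1] := leqP d.1 c.1; rewrite orFb eqn_leq lo_head andbT.
  have [//|l ls <-] := @bot_lo (d :: s); exact: low.
have [//|cd1] := leqP c.2 d.2; rewrite orFb eqn_leq hi_head andTb.
have [//|l ls <-] := @upr_hi (d :: s); exact: upp.
Qed.

Lemma row_meets s k : convex s -> lo s <= k < hi s ->
  exists2 j, j < size s & bot s j <= k < upr s j.
Proof.
elim: s => // c [|d s] IHs; first by rewrite /= maxn0 => _ ck; exists 0.
rewrite convex_cons lo_cons // hi_cons => /and3P[cc /and4P[cd dc _ _] cs] kc.
have [ks|ks] := boolP (lo (d :: s) <= k < hi (d :: s)).
  by have [j js jk] := IHs cs ks; exists j.+1.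
exists 0; rewrite // /bot /upr /=.
have := lo_head d s; have := hi_head d s; lia.
Qed.

(** Attaining the maximal top passes to the tail: either c stays below the top of d, so the top of d
    is maximal too, or c leaves d upwards and [attaches] says so directly. Hence one equality on the
    first column already makes the tops weakly decreasing. *)
Lemma top_firstP s : convex s ->
  reflect (forall i j, i <= j < size s -> upr s j <= upr s i) (top_first s).
Proof.
move=> cs; apply: (iffP idP); last first.
  move=> mono; have s0 : s != [::] by case: (s) cs.
  have [j js jhi] := upr_hi s0; have := mono 0 j js; rewrite jhi.
  have := @upr_le_hi s 0 (leq_ltn_trans (leq0n j) js).
  by rewrite /top_first -nth0 -/(upr s 0) eqn_leq => -> ->.
elim: s cs => // c [|d s] IHs.
  by move=> _ _ i j /= ij; have [-> ->] : i = 0 /\ j = 0 by lia.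
rewrite convex_cons => /and3P[cc /and4P[cd dc _ tv] cs].
rewrite /top_first hi_cons [head _ _]/= => top_c.
have tfd : top_first (d :: s).
  have := hi_head d s; rewrite /top_first [head _ _]/=; lia.
case=> [|i] [|j] //= js; last exact: (IHs cs tfd).
by rewrite -[X in _ <= X]/c.2 (eqP top_c) -hi_cons; apply: upr_le_hi.
Qed.

Lemma bottom_firstP s : convex s ->
  reflect (forall i j, i <= j < size s -> bot s i <= bot s j) (bottom_first s).
Proof.
move=> cs; apply: (iffP idP); last first.
  move=> mono; have s0 : s != [::] by case: (s) cs.
  have [j js jlo] := bot_lo s0; have := mono 0 j js; rewrite jlo.
  have := @bot_ge_lo s 0 (leq_ltn_trans (leq0n j) js).
  by rewrite /bottom_first -nth0 -/(bot s 0) eqn_leq => -> ->.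
elim: s cs => // c [|d s] IHs.
  by move=> _ _ i j /= ij; have [-> ->] : i = 0 /\ j = 0 by lia.
rewrite convex_cons => /and3P[cc /and4P[cd dc bv _] cs].
rewrite /bottom_first lo_cons // [head _ _]/= => bot_c.
have bfd : bottom_first (d :: s).
  have := lo_head d s; rewrite /bottom_first [head _ _]/=; lia.
case=> [|i] [|j] //= js; last exact: (IHs cs bfd).
by rewrite -[X in X <= _]/c.1 (eqP bot_c) -lo_cons //; apply: bot_ge_lo.
Qed.

Lemma flatsE f s : flats f s =
  \sum_(j < (size s).-1) (f (nth (0, 0) s j) == f (nth (0, 0) s j.+1)).
Proof.
elim: s => [|c [|d s] IHs]; rewrite ?big_ord0 //.
by rewrite /= big_ord_recl -[X in _ + X = _]/(flats f (d :: s)) IHs.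
Qed.

End ConvexProfile.

(** * Bijection between convex polyominoes and boxed convex sequences *)

Section PolyominoColumns.
Local Open Scope nat_scope.
Variables m h : nat.
Implicit Types (A : {set 'I_m * 'I_h}) (c d : 'I_m * 'I_h).

Definition cols A : seq column := mkseq (fun j => (bottom A j, top A j)) m.

Definition cells (s : seq column) : {set 'I_m * 'I_h} :=
  [set c : 'I_m * 'I_h | bot s c.1 <= c.2 < upr s c.1].

Lemma size_cols A : size (cols A) = m. Proof. exact: size_mkseq. Qed.

Lemma bot_cols A j : j < m -> bot (cols A) j = bottom A j.
Proof. by move=> jm; rewrite /bot nth_mkseq. Qed.

Lemma upr_cols A j : j < m -> upr (cols A) j = top A j.
Proof. by move=> jm; rewrite /upr nth_mkseq. Qed.

Lemma bottom_le A c : c \in A -> bottom A c.1 <= c.2.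
Proof.
move=> cA; rewrite /bottom; have: c \in index_enum ('I_m * 'I_h)%type.
  exact: mem_index_enum.
elim: (index_enum _) => // d r IHr; rewrite inE big_cons => /orP[/eqP<-|/IHr].
  by rewrite cA eqxx /= geq_minl.
by case: ifP => // _ le; rewrite geq_min le orbT.
Qed.

Lemma top_gt A c : c \in A -> c.2 < top A c.1.
Proof.
by move=> cA; apply: (leq_bigmax_cond (F := fun c => c.2.+1)); rewrite cA eqxx.
Qed.

Lemma bottom_ex A c : c \in A ->
  exists2 k : 'I_h, (c.1, k) \in A & k = bottom A c.1 :> nat.
Proof.
(* The minimum is attained or equals its default h, and h exceeds the height of every cell. *)
move=> cA; have [E|//] : bottom A c.1 = h \/
    exists2 k : 'I_h, (c.1, k) \in A & k = bottom A c.1 :> nat.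
  rewrite /bottom; apply: (big_ind (fun x => x = h \/
    exists2 k : 'I_h, (c.1, k) \in A & k = x :> nat)); first by left.
    by move=> x y hx hy; rewrite /minn; case: ifP.
  move=> d /andP[dA /eqP/val_inj dc]; right; exists d.2; rewrite // -dc.
  by rewrite -surjective_pairing.
by have := bottom_le cA; have := ltn_ord c.2; lia.
Qed.

Lemma top_ex A c : c \in A ->
  exists2 k : 'I_h, (c.1, k) \in A & k.+1 = top A c.1.
Proof.
move=> cA; have [E|//] : top A c.1 = 0 \/
    exists2 k : 'I_h, (c.1, k) \in A & k.+1 = top A c.1.
  rewrite /top; apply: (big_ind (fun x => x = 0 \/
    exists2 k : 'I_h, (c.1, k) \in A & k.+1 = x)); first by left.
    by move=> x y hx hy; rewrite /maxn; case: ifP.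
  move=> d /andP[dA /eqP/val_inj dc]; right; exists d.2; rewrite // -dc.
  by rewrite -surjective_pairing.
by have := top_gt cA; lia.
Qed.

Lemma mem_CP A c : CP A -> (c \in A) = (bottom A c.1 <= c.2 < top A c.1).
Proof.
move=> /and3P[/and3P[_ _ /andP[/forallP colA _]] /forallP ccA _].
apply/idP/idP => [cA|/andP[bc ct]]; first by rewrite bottom_le ?top_gt.
have /existsP[k kA] := colA c.1.
have [k1 k1A k1E] := bottom_ex kA; have [k2 k2A k2E] := top_ex kA.
rewrite /= in k1A k1E k2A k2E.
have /forallP/(_ k1)/forallP/(_ c.2)/forallP/(_ k2)/implyP := ccA c.1.
by rewrite -surjective_pairing; apply; rewrite k1A k2A k1E bc -ltnS k2E.
Qed.

Lemma cells_cols A : CP A -> cells (cols A) = A.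
Proof.
by move=> cpA; apply/setP => c; rewrite inE bot_cols // upr_cols // -mem_CP.
Qed.

(** If columns j and j + 1 shared no row, the cells of index at most j would be closed under
    adjacency, so no path could lead from column j to column j + 1. *)
Lemma adjacent_overlap A j : edge_connected A -> j.+1 < m ->
    (forall i : 'I_m, exists k : 'I_h, (i, k) \in A) ->
  exists k i i', [/\ (i, k) \in A, (i', k) \in A, i = j :> nat & i' = j.+1 :> nat].
Proof.
move=> conA jm colA; apply: boolp.contrapT => none.
pose e := [rel c' d' | [&& c' \in A, d' \in A & edge_adjacent c' d']].
have cl : closed e [pred c : 'I_m * 'I_h | c.1 <= j].
  move=> [i1 k1] [i2 k2] /and3P[A1 A2]; rewrite /edge_adjacent !inE /=.
  case/orP => [/andP[/eqP-> _] //|/andP[/eqP kk ii]]; subst k2.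
  apply: boolp.contrapT => ij; apply: none.
  have [i12|i21] : (i1 = j :> nat /\ i2 = j.+1 :> nat) \/
                   (i2 = j :> nat /\ i1 = j.+1 :> nat) by lia.
    by exists k1, i1, i2; case: i12.
  by exists k1, i2, i1; case: i21.
have [k kA] := colA (Ordinal (ltnW jm)); have [k' kA'] := colA (Ordinal jm).
have /forallP/(_ (Ordinal (ltnW jm), k))/implyP/(_ kA) := conA.
move=> /forallP/(_ (Ordinal jm, k'))/implyP/(_ kA')/(closed_connect cl).
by rewrite !inE /= leqnn ltnn.
Qed.

Lemma CP_boxed A : CP A -> (cols A \in col_seqs h m) && boxed 0 h (cols A).
Proof.
move=> cpA; 
have /and3P[/and3P[A0 conA /andP[/forallP colA /forallP rowA]] _] := cpA.
move=> /forallP rcA.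
have colA' i : exists k, (i, k) \in A by apply/existsP.
have memA (i : 'I_m) (k : 'I_h) : ((i, k) \in A) = (bot (cols A) i <= k < upr (cols A) i).
  by rewrite (mem_CP _ cpA) bot_cols ?upr_cols.
have m0 : 0 < m by case/set0Pn: A0 => -[i _] _; apply: leq_trans (ltn_ord i).
have s0 : cols A != [::] by rewrite -size_eq0 size_cols -lt0n.
have lt j : j < m -> bot (cols A) j < upr (cols A) j <= h.
  move=> jm; have [k kA] := colA' (Ordinal jm); move: (kA); rewrite memA /= => kj.
  have [k2 _] := top_ex kA; rewrite -upr_cols //= => k2E.
  by have := ltn_ord k2; lia.
have cs : convex (cols A).
  apply: row_connected_convex; rewrite ?size_cols //.
  - by move=> j /lt /andP[].
  - move=> j; rewrite size_cols => jm.
    have [k [i [i' []]]] := adjacent_overlap conA jm colA'.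
    by rewrite !memA => hi hi' ij ij'; move: hi hi'; rewrite ij ij'; lia.
  move=> k i j l /andP[ij jl]; rewrite size_cols => lm ik lk.
  have jm := leq_ltn_trans jl lm; have im := leq_ltn_trans ij jm.
  have kh : k < h by have := lt i im; move: ik; lia.
  have /forallP/(_ (Ordinal im))/forallP/(_ (Ordinal jm))/forallP/(_ (Ordinal lm)) :=
    rcA (Ordinal kh).
  by rewrite !memA /= ik lk ij jl.
rewrite /boxed cs mem_col_seqs size_cols eqxx !andTb.
have h0 : 0 < h by have := lt 0 m0; lia.
apply/and3P; split.
- apply/allP => c /mapP[j]; rewrite mem_iota => jm ->.
  have := lt j jm; rewrite bot_cols // upr_cols // => /andP[bt th] /=.
  by rewrite mem_columns /= th (leq_trans (ltnW bt)).
- have /existsP[j] := rowA (Ordinal h0); rewrite memA => /andP[b0 _].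
  by rewrite -leqn0 (leq_trans _ b0) // bot_ge_lo // size_cols.
(* [rev_ord] of row 0 is the top row h - 1; as it is occupied, the maximal top is h. *)
have /existsP[j] := rowA (rev_ord (Ordinal h0)); rewrite memA => /andP[_ th].
rewrite eqn_leq; apply/andP; split.
  have [i im <-] := upr_hi s0; rewrite size_cols in im.
  by case/andP: (lt i im).
move: th; rewrite /= subn1 prednK // => th; apply: leq_trans th _.
by rewrite upr_le_hi // size_cols.
Qed.

Lemma edge_adjacent_sym : symmetric (@edge_adjacent m h).
Proof.
move=> [i k] [j l]; rewrite /edge_adjacent /= [j == i]eq_sym [l == k]eq_sym.
by congr (_ && _ || _ && _); rewrite orbC.
Qed.

Section Cells.
Variable s : seq column.
Hypotheses (cs : convex s) (sm : size s = m) (los : lo s = 0) (his : hi s = h).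

Let e := [rel c d | [&& c \in cells s, d \in cells s & edge_adjacent c d]].

Let lt_upr j : j < m -> bot s j < upr s j.
Proof. by move=> jm; apply/(convex_lt cs)/mem_nth; rewrite sm. Qed.

Let upr_h j : j < m -> upr s j <= h.
Proof. by move=> jm; rewrite -his upr_le_hi // sm. Qed.

Lemma connect_cells_sym : connect_sym e.
Proof.
by apply: sym_connect_sym => c d; rewrite /= edge_adjacent_sym andbCA.
Qed.

Lemma connect_vertical (j : 'I_m) (k k' : 'I_h) :
  (j, k) \in cells s -> (j, k') \in cells s -> connect e (j, k) (j, k').
Proof.
wlog kk : k k' / k <= k'.
  move=> th; have [/th//|/ltnW/th + kj k'j] := leqP k k'.
  by move=> /(_ k'j kj); rewrite connect_cells_sym.
move=> kj; move Ek' : (k' : nat) kk => n; elim: n k' Ek' => [|n IHn] k' k'n kn k'j.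
  by have -> : k = k' by apply: val_inj => /=; lia.
have [E|kn'] : k = k' \/ k <= n.
    by have [E|] := eqVneq (k : nat) n.+1; [left; apply: val_inj => /=; lia|right; lia].
  by rewrite E.
have nh : n < h by have := ltn_ord k'; lia.
have nj : (j, Ordinal nh) \in cells s by move: kj k'j; rewrite !inE /=; lia.
apply: connect_trans (IHn (Ordinal nh) erefl kn' nj) (connect1 _).
by rewrite /= nj k'j /edge_adjacent /= eqxx k'n eqxx.
Qed.

Lemma connect_cells c d : c \in cells s -> d \in cells s -> connect e c d.
Proof.
case: c d => [i k] [j l].
have main n : forall (i' j' : 'I_m) k' l', i' = 0 :> nat -> j' = n :> nat ->
    (i', k') \in cells s -> (j', l') \in cells s -> connect e (i', k') (j', l').
  elim: n => [|n IHn] i' j' k' l' i0 jn ic jc.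
    have E : i' = j' by apply: val_inj; rewrite /= i0 jn.
    by subst i'; apply: connect_vertical.
  have nm : n.+1 < m by rewrite -jn.
  have nm' := ltnW nm.
  have [o1 o2] : bot s n < upr s n.+1 /\ bot s n.+1 < upr s n.
    by apply: (convex_overlapping cs); rewrite sm.
  have b1 := lt_upr nm'; have b2 := lt_upr nm; have uh := upr_h nm.
  (* The higher of the two bottoms is a row common to both overlapping columns; the path crosses
     there. *)
  have rh : maxn (bot s n) (bot s n.+1) < h by lia.
  have c1 : (Ordinal nm', Ordinal rh) \in cells s by rewrite inE /=; lia.
  have c2 : (j', Ordinal rh) \in cells s by rewrite inE /= jn; lia.
  apply: connect_trans (IHn i' (Ordinal nm') k' _ i0 erefl ic c1) _.
  apply: connect_trans (connect_vertical c2 jc); apply: connect1.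
  by rewrite /= c1 c2 /edge_adjacent /= eqxx jn eqxx orbT.
move=> ic jc; have m0 : 0 < m by apply: leq_trans (ltn_ord i).
have h0 : bot s 0 < h by have := upr_h m0; have := lt_upr m0; lia.
have c0 : (Ordinal m0, Ordinal h0) \in cells s by rewrite inE /= leqnn lt_upr.
apply: connect_trans (main j (Ordinal m0) j _ l erefl erefl c0 jc).
by rewrite connect_cells_sym; exact: (main i).
Qed.

Lemma cells_CP : CP (cells s).
Proof.
have s0 : s != [::] by case: (s) cs.
have m0 : 0 < m by rewrite -sm lt0n size_eq0.
have col (j : 'I_m) : exists k : 'I_h, (j, k) \in cells s.
  have jh : bot s j < h.
    by apply: leq_trans (lt_upr (ltn_ord j)) (upr_h (ltn_ord j)).
  by exists (Ordinal jh); rewrite inE /= leqnn lt_upr.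
apply/and3P; split; first (apply/and3P; split).
- by have [k kc] := col (Ordinal m0); apply/set0Pn; exists (Ordinal m0, k).
- by do 2!apply/'forall_implyP => ? ?; exact: connect_cells.
- apply/andP; split; apply/forallP => i; apply/existsP; first exact: col.
  have [|j jm ij] := @row_meets s i cs; first by rewrite los his /=.
  by rewrite sm in jm; exists (Ordinal jm); rewrite inE.
- apply/forallP => j; apply/forallP => k1; apply/forallP => k; apply/forallP => k2.
  by apply/implyP; rewrite !inE /=; lia.
apply/forallP => k; apply/forallP => i; apply/forallP => j; apply/forallP => l.
apply/implyP; rewrite !inE /= => /and4P[ik lk ij jl].
by apply: (convex_row_connected cs _ _ ik lk); rewrite ?ij ?sm.
Qed.

Lemma cols_cells : cols (cells s) = s.
Proof.
apply: (@eq_from_nth _ (0, 0)) => [|j]; first by rewrite size_cols sm.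
rewrite size_cols => jm; rewrite [LHS]surjective_pairing [RHS]surjective_pairing.
rewrite -/(bot _ j) -/(upr _ j) -/(bot s j) -/(upr s j) bot_cols // upr_cols //.
have bj := lt_upr jm; have uj := upr_h jm.
have bh : bot s j < h by lia.
have uh : (upr s j).-1 < h by lia.
have bc : (Ordinal jm, Ordinal bh) \in cells s by rewrite inE /= leqnn.
have uc : (Ordinal jm, Ordinal uh) \in cells s by rewrite inE /=; lia.
have := bottom_le bc; have := top_gt uc; rewrite /=.
have [k + kE] := bottom_ex bc; have [k' + k'E] := top_ex uc.
rewrite /= in kE k'E; rewrite !inE /= -kE -k'E => ? ? ? ?; congr pair; lia.
Qed.

End Cells.

(** [cols] and [cells] are mutually inverse, so sums over polyominoes become sums over sequences. *)
Lemma perm_cols : perm_eq [seq cols A | A <- enum (@CP m h)]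
  [seq s <- col_seqs h m | boxed 0 h s].
Proof.
apply: uniq_perm.
- rewrite map_inj_in_uniq ?enum_uniq // => A A'.
  by rewrite !mem_enum => cA cA' EA; rewrite -(cells_cols cA) EA cells_cols.
- exact/filter_uniq/uniq_col_seqs.
move=> s; rewrite mem_filter andbC; apply/mapP/idP => [[A]|].
  by rewrite mem_enum => cA ->; apply: CP_boxed.
rewrite mem_col_seqs => /andP[/andP[/eqP sm _] /and3P[cs /eqP los /eqP his]].
by exists (cells s); rewrite ?mem_enum ?cols_cells //; apply: cells_CP.
Qed.

Lemma CP_convex A : CP A -> convex (cols A).
Proof. by move=> /CP_boxed /andP[_ /andP[]]. Qed.

Lemma CPtE A : CPt A = CP A && top_first (cols A).
Proof.
rewrite /CPt; have [cA|//] := boolP (CP A); rewrite /=.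
apply/forallP/(top_firstP (CP_convex cA)) => [mono i j|mono j].
  rewrite size_cols => /andP[]; rewrite leq_eqVlt => /orP[/eqP->//|ij jm].
  have im := ltn_trans ij jm; rewrite !upr_cols //.
  by have /forallP/(_ (Ordinal im))/implyP/(_ ij) := mono (Ordinal jm).
apply/forallP => i; apply/implyP => ij.
by rewrite -!upr_cols // mono // size_cols ltn_ord ltnW.
Qed.

Lemma CPbE A : CPb A = CP A && bottom_first (cols A).
Proof.
rewrite /CPb; have [cA|//] := boolP (CP A); rewrite /=.
apply/forallP/(bottom_firstP (CP_convex cA)) => [mono i j|mono j].
  rewrite size_cols => /andP[]; rewrite leq_eqVlt => /orP[/eqP->//|ij jm].
  have im := ltn_trans ij jm; rewrite !bot_cols //.
  by have /forallP/(_ (Ordinal im))/implyP/(_ ij) := mono (Ordinal jm).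
apply/forallP => i; apply/implyP => ij.
by rewrite -!bot_cols // mono // size_cols ltn_ord ltnW.
Qed.

Lemma CPbtE A : CPbt A = CP A && predI top_first bottom_first (cols A).
Proof. by rewrite /CPbt CPtE CPbE /=; case: (CP A). Qed.

Lemma statBE A : statB A = flats fst (cols A).
Proof.
rewrite flatsE /statB -sum1dep_card big_mkcond size_cols; apply: eq_bigr => j _.
have jm : j.+1 < m by have := ltn_ord j; lia.
by rewrite -/(bot _ j) -/(bot _ j.+1) !bot_cols ?(ltnW jm) //; case: eqP.
Qed.

Lemma statUE A : statU A = flats snd (cols A).
Proof.
rewrite flatsE /statU -sum1dep_card big_mkcond size_cols; apply: eq_bigr => j _.
have jm : j.+1 < m by have := ltn_ord j; lia.
by rewrite -/(upr _ j) -/(upr _ j.+1) !upr_cols ?(ltnW jm) //; case: eqP.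
Qed.

Lemma stataE A : CP A -> stata A = height (cols A).
Proof.
move=> cA; have /set0Pn[c _] : A != set0 by case/and3P: cA => /and3P[].
have m0 : 0 < m by apply: leq_trans (ltn_ord c.1).
have /andP[+ /and3P[_ _ /eqP his]] := CP_boxed cA; rewrite mem_col_seqs => _.
rewrite /height -nth0 -/(bot _ 0) -/(upr _ 0).
have uh : upr (cols A) 0 <= h by rewrite -his upr_le_hi // size_cols.
have E : [set c in A | c.1 == 0 :> nat] =
    pair (Ordinal m0) @: [set k : 'I_h | bot (cols A) 0 <= k < upr (cols A) 0].
  apply/setP => -[i k]; rewrite inE (mem_CP _ cA) /=; apply/idP/imsetP.
    move=> /andP[ik /eqP i0]; exists k; first by rewrite inE bot_cols ?upr_cols -?i0.
    by congr pair; apply: val_inj.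
  by move=> [k']; rewrite inE bot_cols ?upr_cols // => kb [-> ->]; rewrite kb.
rewrite /stata E card_imset; last by move=> ? ? [].
rewrite -sum1dep_card -(big_mkord (fun k => _ <= k < _) (fun=> 1)).
rewrite (eq_bigl (fun k => (true && (k < upr (cols A) 0)) && (bot (cols A) 0 <= k))).
  by rewrite -big_nat_widenl // -big_nat_widen // sum_nat_const_nat muln1.
by move=> k; rewrite andbC.
Qed.

End PolyominoColumns.

(** * Removing the leftmost column *)

Section ColumnSums.
Variables (K : comNzRingType) (p q : K).
Implicit Types (w : nat -> K) (s : seq column) (S : pred (seq column)).

Definition weight s : K := p ^+ flats fst s * q ^+ flats snd s.

Definition colsum N m l r S w : K :=
  \sum_(s <- col_seqs N m | boxed l r s && S s) weight s * w (height s).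

(** Columns of a convex sequence have positive height, so w may be changed at 0, where the closed
    forms below are not claimed. *)
Lemma colsum_eq N m l r S w w' :
    (forall n, (0 < n)%N -> w n = w' n) ->
  colsum N m l r S w = colsum N m l r S w'.
Proof.
move=> ww; apply: eq_bigr => s /andP[/andP[cs _] _]; congr (_ * _); apply: ww.
by rewrite /height subn_gt0; case: (convex_bounds cs).
Qed.

Lemma weight_shift k s : weight (shift k s) = weight s.
Proof. by rewrite /weight; have [-> ->] := flats_shift k s. Qed.

Lemma colsum_shift N m l r S w :
    (r <= N)%N -> (forall s, s != [::] -> S (shift l s) = S s) ->
  colsum N m l r S w = colsum (r - l)%N m 0 (r - l)%N S w.
Proof.
move=> rN Sl; rewrite /colsum -big_filter (perm_big _ (perm_shift m rN Sl)) /=.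
rewrite big_map big_filter; apply: eq_bigr => s _.
by rewrite weight_shift height_shift.
Qed.

(* The ways to place a new column beside one of height n: with [side z j n w] *)
(* it overhangs by j at one end and moves inwards at the other, the factor z  *)
(* marking a flush end; with [inside n w] it does not overhang.               *)
Definition side z j n w := \sum_(1 <= k < n.+1) z ^+ (k == n) * w (k + j)%N.
Definition inside n w := \sum_(c < n) p ^+ (c == 0 :> nat) * side q 0 (n - c)%N w.

(** The first five conditions are those of [convex] and [attaches], with l and r standing for [lo]
    and [hi] of the tail; the last two say that the enlarged box is [0, h). *)
Definition place h (d : column) l r w : K :=
  \sum_(c <- columns h | [&& (c.1 < c.2)%N, (c.1 < d.2)%N, (d.1 < c.2)%N,
         (d.1 <= c.1)%N || (d.1 == l), (c.2 <= d.2)%N || (d.2 == r),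
         minn c.1 l == 0%N & maxn c.2 r == h])
     p ^+ (c.1 == d.1) * q ^+ (c.2 == d.2) * w (c.2 - c.1)%N.

Lemma place_nested (A : pred nat) (B : nat -> pred nat) h d l r w :
    (forall b t, (b <= h)%N -> (t <= h)%N ->
      [&& (b < t)%N, (b < d.2)%N, (d.1 < t)%N, (d.1 <= b)%N || (d.1 == l),
          (t <= d.2)%N || (d.2 == r), minn b l == 0%N & maxn t r == h] =
      A b && B b t) ->
  place h d l r w = \sum_(0 <= b < h.+1 | A b) \sum_(0 <= t < h.+1 | B b t)
    p ^+ (b == d.1) * q ^+ (t == d.2) * w (t - b)%N.
Proof.
move=> AB; rewrite /place big_mkcond /= big_allpairs [RHS]big_mkcond /=.
apply: eq_big_nat => b /andP[_]; rewrite ltnS => bh.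
have {}AB t := AB b t bh; case: (A b) AB => AB.
  rewrite [RHS]big_mkcond /=; apply: eq_big_nat => t /andP[_].
  by rewrite ltnS => th; rewrite AB.
by rewrite big_nat big1 // => t /andP[_]; rewrite ltnS => th; rewrite AB.
Qed.

Lemma sum_nat_pick (F : nat -> K) k n :
  (k < n)%N -> \sum_(0 <= i < n | i == k) F i = F k.
Proof. by move=> kn; rewrite big_mkord (big_pred1 (Ordinal kn)). Qed.

Lemma place00 h d w : (d.1 < d.2 <= h)%N -> place h d 0 h w = inside (d.2 - d.1)%N w.
Proof.
move=> /andP[d12 dh].
(* The conditions are written with [true &&] to match [big_nat_widen] and [big_nat_widenl] read
   backwards, which turn them into summation bounds. *)
rewrite (@place_nested (fun b => (true && (b < d.2)) && (d.1 <= b))%N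
  (fun b t => (true && (t < d.2.+1)) && (1 + b <= t))%N); last by lia.
rewrite -big_nat_widenl // -big_nat_widen 1?ltnW //.
rewrite -[d.1 in LHS]add0n big_addn /inside big_mkord; apply: eq_bigr => c _.
rewrite -big_nat_widenl // -big_nat_widen // big_addn /side mulr_sumr.
have -> : (c + d.1 == d.1)%N = (c == 0 :> nat) by lia.
rewrite -subSn; last by have := ltn_ord c; lia.
have -> : (d.2.+1 - (c + d.1) = (d.2 - d.1).+1 - c)%N by lia.
apply: eq_big_nat => k kb; rewrite mulrA addnK addn0.
by have -> : (k + (c + d.1) == d.2)%N = (k == d.2 - d.1 - c)%N by lia.
Qed.

(** The tail stops at r < h, so the new column must reach h. It then overhangs d, which requires d.2
    = r, and only its bottom can be flush. *)
Lemma place_top h d r w : (d.1 < d.2 <= r)%N -> (r < h)%N ->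
  place h d 0 r w = if d.2 == r then side p (h - r)%N (d.2 - d.1)%N w else 0.
Proof.
move=> /andP[d12 dr] rh; case: eqP => [dE|dE]; last first.
  by rewrite /place big1_seq // => c /andP[]; lia.
rewrite (@place_nested (fun b => (true && (b < d.2)) && (d.1 <= b))%N
  (fun b t => t == h)%N); last by lia.
rewrite -big_nat_widenl // -big_nat_widen; last by lia.
(* Bottoms are counted down from d.2, so that the index is the number of rows shared with d. *)
rewrite big_nat_rev /side -[d.1 in LHS]add0n big_addn [RHS]big_add1 /=.
apply: eq_big_nat => k kb; rewrite sum_nat_pick // -mulrA.
have -> : (0 + d.1 + d.2 - (k + d.1).+1 == d.1)%N = (k.+1 == d.2 - d.1)%N by lia.
have -> : (h == d.2) = false by lia.
by rewrite mul1r; congr (_ * w _); lia.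
Qed.

Lemma place_bottom h d l w : (0 < l <= d.1)%N -> (d.1 < d.2 <= h)%N ->
  place h d l h w = if d.1 == l then side q l (d.2 - d.1)%N w else 0.
Proof.
move=> /andP[l0 ld] /andP[d12 dh]; case: eqP => [dE|dE]; last first.
  by rewrite /place big1_seq // => c /andP[]; lia.
rewrite (@place_nested (fun b => b == 0)%N
  (fun b t => (true && (t < d.2.+1)) && (1 + d.1 <= t))%N); last by lia.
rewrite sum_nat_pick // -big_nat_widenl // -big_nat_widen // big_addn /side.
rewrite -subSn 1?ltnW //; apply: eq_big_nat => k kb.
have -> : (0 == d.1)%N = false by lia.
rewrite mul1r subn0; congr (q ^+ _ * w _); lia.
Qed.

Lemma place_both h d l r w :
    (0 < l <= d.1)%N -> (d.1 < d.2 <= r)%N -> (r < h)%N ->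
  place h d l r w =
    if (d.2 == r) && (d.1 == l) then w (d.2 - d.1 + l + (h - r))%N else 0.
Proof.
move=> /andP[l0 ld] /andP[d12 dr] rh; case: ifP => dE; last first.
  by rewrite /place big1_seq // => c /andP[]; lia.
rewrite (@place_nested (fun b => b == 0)%N (fun b t => t == h)%N); last by lia.
rewrite !sum_nat_pick //.
have -> : (0 == d.1)%N = false by lia.
have -> : (h == d.2) = false by lia.
rewrite !mul1r; congr w; lia.
Qed.

(** Whether c may precede s depends on s only through its first column, [lo s] and [hi s]; the sum
    over c is therefore a [place]. *)
Lemma colsumS h m w :
  colsum h m.+2 0 h predT w =
  \sum_(s <- col_seqs h m.+1 | convex s)
    weight s * place h (head (0, 0)%N s) (lo s) (hi s) w.
Proof.
rewrite /colsum col_seqsS big_mkcond big_allpairs_dep /= exchange_big /=.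
rewrite [LHS]big_seq_cond [RHS]big_mkcond [RHS]big_seq_cond /=.
apply: eq_bigr => -[|d s]; first by rewrite mem_col_seqs.
move=> _; have [cs|cs] := boolP (convex (d :: s)); last first.
  by rewrite big1 // => c _; rewrite /boxed convex_cons (negbTE cs) !andbF.
rewrite /place mulr_sumr [RHS]big_mkcond /=; apply: eq_bigr => c _.
rewrite andbT /boxed convex_cons cs andbT lo_cons // hi_cons /attaches -!andbA.
case: ifP => // _; rewrite /weight /height /= -![c.1 == d.1]/(c.1 == d.1).
by rewrite !exprD; ring.
Qed.

(** The four sums correspond to tails whose box is [0, h), [0, r), [l, h) and [l, r), with l > 0 and
    r < h: the new column has to supply the missing rows. *)
Lemma colsum_step h m w :
  colsum h m.+2 0 h predT w =
    colsum h m.+1 0 h predT (inside^~ w)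
  + \sum_(0 <= r < h) colsum h m.+1 0 r top_first (fun n => side p (h - r)%N n w)
  + \sum_(1 <= l < h.+1)
      colsum h m.+1 l h bottom_first (fun n => side q l n w)
  + \sum_(1 <= l < h.+1) \sum_(0 <= r < h)
      colsum h m.+1 l r (predI top_first bottom_first)
        (fun n => w (n + l + (h - r))%N).
Proof.
(* For a fixed s, [boxed l r s] forces l = [lo s] and r = [hi s], so each sum over l or r has at
   most one nonzero term. *)
have pick a b k (e : nat -> bool) (F : nat -> K) :
    (forall i, e i -> i == k) ->
    \sum_(a <= i < b) (if e i then F i else 0) =
    if (a <= k < b)%N && e k then F k else 0.
  move=> ek; case: ifP => [/andP[kab ekk]|kab].
    rewrite (bigD1_seq k) ?mem_index_iota ?iota_uniq //= ekk big1 ?addr0 // => i.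
    by case: ifP => // /ek->.
  rewrite big_nat big1 // => i iab; case: ifP => // ei; move: kab.
  by rewrite -(eqP (ek i ei)) iab ei.
have colsumE N n l r S f : colsum N n l r S f = \sum_(s <- col_seqs N n)
    if boxed l r s && S s then weight s * f (height s) else 0.
  by rewrite /colsum big_mkcond.
rewrite colsumS colsumE.
under [in X in _ + X + _ + _]eq_bigr do rewrite colsumE.
under [in X in _ + _ + X + _]eq_bigr do rewrite colsumE.
under [in X in _ + _ + _ + X]eq_bigr => l _ do
  (under eq_bigr do rewrite colsumE; rewrite exchange_big /=).
rewrite [in X in _ + X + _ + _]exchange_big [in X in _ + _ + X + _]exchange_big.
rewrite [in X in _ + _ + _ + X]exchange_big -!big_split big_mkcond /=.
apply: eq_big_seq => s sh; have his := hi_col_seqs sh.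
case: ifP => cs; last first.
  rewrite /boxed cs /= !big1 ?addr0 // => ? _; rewrite ?big1 // => ? _.
have [lod d12 dhi] := convex_bounds cs; have lohi := ltn_lo_hi cs.
under [in X in _ + _ + _ + X]eq_bigr => l _ do
  (rewrite (pick _ _ (hi s)); last by move=> ? /andP[/and3P[_ _]]; rewrite eq_sym).
rewrite (pick _ _ (hi s)); last by move=> ? /andP[/and3P[_ _]]; rewrite eq_sym.
rewrite (pick _ _ (lo s)); last by move=> ? /andP[/and3P[_]]; rewrite eq_sym.
rewrite (pick _ _ (lo s)); last first.
  by move=> ? /andP[_] /andP[/and3P[_]]; rewrite eq_sym.
rewrite /boxed cs !eqxx /height /top_first /bottom_first /= !andbT ltnS.
have [l0|l0] := posnP (lo s); have [rh|rh] := eqVneq (hi s) h.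
- rewrite l0 rh ltnn place00 ?d12 -?rh //= ?addr0 //.
- have {}rh : (hi s < h)%N by lia.
  rewrite l0 rh /= place_top ?d12 //= addr0 add0r addr0.
  by case: eqP => _; rewrite ?mulr0.
- rewrite rh ltnn /= place_bottom ?l0 ?d12 -?rh //= !addr0 add0r ltnW //=.
  by rewrite addr0; case: eqP => _; rewrite ?mulr0.
- have {}rh : (hi s < h)%N by lia.
  rewrite rh place_both ?l0 ?d12 // (ltnW (ltn_trans lohi rh)) /=.
  rewrite !add0r.
  by case: ifP => _; rewrite ?mulr0.
Qed.

End ColumnSums.

(** * Reflection in a horizontal line *)

Section Flip.
Local Open Scope nat_scope.
Implicit Types (c d : column) (s : seq column).

(** The subtraction truncates, hence the hypothesis [hi s <= h] in what follows. *)
Definition flip h s := [seq (h - c.2, h - c.1) | c : column <- s].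

Lemma flip_cons h c s : flip h (c :: s) = (h - c.2, h - c.1) :: flip h s.
Proof. by []. Qed.

Lemma flipK h s : convex s -> hi s <= h -> flip h (flip h s) = s.
Proof.
move=> cs his; rewrite /flip -map_comp map_id_in // => c cs' /=.
have := hi_ge cs'; have := convex_lt cs cs' => ? ?.
by rewrite !subKn; [case: (c)|lia|lia].
Qed.

Lemma lo_flip h s : s != [::] -> lo (flip h s) = h - hi s.
Proof.
elim: s => // c [|d s] IHs _; first by rewrite /= maxn0.
by rewrite [flip _ _]/= lo_cons // IHs // (hi_cons c) /=; lia.
Qed.

Lemma hi_flip h s : s != [::] -> hi (flip h s) = h - lo s.
Proof.
elim: s => // c [|d s] IHs _; first by rewrite /= maxn0.
by rewrite [flip _ _]/= hi_cons IHs // (lo_cons c) //=; lia.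
Qed.

Lemma convex_flip h s : convex s -> hi s <= h -> convex (flip h s).
Proof.
elim: s => // c [|d s] IHs; first by rewrite /=; lia.
rewrite convex_cons => /and3P[cc att cs].
rewrite hi_cons geq_max => /andP[ch sh].
have := hi_head d s; have := lo_head d s; have := ltn_lo_hi cs.
have [_ dd _] := convex_bounds cs; rewrite /= in dd.
rewrite 2!flip_cons convex_cons -flip_cons IHs // andbT.
by move: att; rewrite /attaches lo_flip // hi_flip //=; lia.
Qed.

Lemma flats_flip h s : convex s -> hi s <= h ->
  flats fst (flip h s) = flats snd s /\ flats snd (flip h s) = flats fst s.
Proof.
elim: s => // c [|d s] IHs //.
rewrite convex_cons hi_cons geq_max => /and3P[cc att cs] /andP[ch sh].
have [E1 E2] := IHs cs sh; have := hi_head d s.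
have [_ dd _] := convex_bounds cs; rewrite /= in dd => dh.
split.
  rewrite -[LHS]/((h - c.2 == h - d.2) + flats fst (flip h (d :: s))).
  by rewrite -[RHS]/((c.2 == d.2) + flats snd (d :: s)) E1; lia.
rewrite -[LHS]/((h - c.1 == h - d.1) + flats snd (flip h (d :: s))).
by rewrite -[RHS]/((c.1 == d.1) + flats fst (d :: s)) E2; lia.
Qed.

Lemma height_flip h s : convex s -> hi s <= h -> height (flip h s) = height s.
Proof.
case: s => // c s /convex_bounds[_]; rewrite flip_cons /height /=; lia.
Qed.

Lemma bottom_first_flip h s : convex s -> hi s <= h ->
  bottom_first (flip h s) = top_first s.
Proof.
move=> cs sh; have s0 : s != [::] by case: (s) cs.
rewrite /bottom_first lo_flip // /top_first; case: s cs sh {s0} => // c s.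
by move=> /convex_bounds[_ _]; rewrite flip_cons; case: (hi (c :: s)) => /=; lia.
Qed.

Lemma perm_flip h m :
  perm_eq [seq s <- col_seqs h m | boxed 0 h s && bottom_first s]
    (map (flip h) [seq s <- col_seqs h m | boxed 0 h s && top_first s]).
Proof.
have flips s : s \in [seq s <- col_seqs h m | boxed 0 h s] ->
    flip h s \in [seq s <- col_seqs h m | boxed 0 h s].
  rewrite !mem_filter !mem_col_seqs size_map.
  move=> /andP[/and3P[cs /eqP los /eqP his] /andP[-> _]].
  have s0 : s != [::] by case: (s) cs.
  rewrite /boxed convex_flip ?his // lo_flip // hi_flip // los his subnn subn0.
  rewrite !eqxx /=; apply/allP => c' /mapP[c _ ->] /=.
  by rewrite mem_columns /= !leq_subr.
have box s : s \in [seq s <- col_seqs h m | boxed 0 h s] -> convex s /\ hi s <= h.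
  by rewrite mem_filter => /andP[/and3P[-> _ /eqP->]].
have inS S s : (s \in [seq s <- col_seqs h m | boxed 0 h s && S s]) =
    (s \in [seq s <- col_seqs h m | boxed 0 h s]) && S s.
  by rewrite !mem_filter andbAC.
apply: uniq_perm; rewrite ?filter_uniq ?uniq_col_seqs //.
  rewrite map_inj_in_uniq ?filter_uniq ?uniq_col_seqs // => s t.
  rewrite !inS => /andP[/box[cs hs] _] /andP[/box[ct ht] _] st.
  by rewrite -(flipK cs hs) st flipK.
move=> s; apply/idP/mapP.
  rewrite inS => /andP[sb bs]; have [cs hs] := box _ sb.
  exists (flip h s); last by rewrite flipK.
  have [cf hf] := box _ (flips _ sb).
  by rewrite inS flips //= -(bottom_first_flip cf hf) flipK.
move=> [t]; rewrite !inS => /andP[tb tt ->]; have [ct ht] := box _ tb.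
by rewrite flips //= bottom_first_flip.
Qed.

End Flip.

(** Reflection preserves heights and exchanges tops with bottoms, hence the flat steps marked by q
    with those marked by p. *)
Lemma colsum_flip (K : comNzRingType) (p q : K) h m w :
  colsum p q h m 0 h bottom_first w = colsum q p h m 0 h top_first w.
Proof.
rewrite /colsum -big_filter (perm_big _ (perm_flip h m)) /= big_map big_filter.
apply: eq_bigr => s /andP[/and3P[cs _ /eqP hs] _].
have {}hs : (hi s <= h)%N by rewrite hs.
by rewrite height_flip // /weight; have [-> ->] := flats_flip cs hs; rewrite [X in X * _]mulrC.
Qed.

(** * Closed forms of the placements, and the recurrence between series in y *)

Section Recurrence.
Variables (K : comNzRingType) (p q u : K).
Implicit Types (w : nat -> K) (S : pred (seq column)).

Let v : K := 1 - u.
Definition pow n : K := u ^+ n.-1.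
(** For w = [pow], this and [inside_closed] are v times [side] (up to u^j) and v^2 times [inside].
    Multiplying by v = 1 - u replaces the division in a geometric sum, since v need not be a
    unit. *)
Definition side_closed z n : K := v * z * pow n + 1 - pow n.
Definition inside_closed n : K :=
  v ^+ 2 * p * q * pow n + (p + q) * v * (1 - pow n) + v * n.-1%:R - (1 - pow n).

Lemma geom_sum n : v * \sum_(0 <= k < n) u ^+ k = 1 - u ^+ n.
Proof.
elim: n => [|n IHn]; first by rewrite big_geq // mulr0 expr0 subrr.
by rewrite big_nat_recr //= mulrDr IHn exprS /v; ring.
Qed.

Lemma sideE z j n : (0 < n)%N -> v * side z j n pow = u ^+ j * side_closed z n.
Proof.
case: n => // n _; rewrite /side big_nat_recr //= eqxx big_add1 /= mulrDr.
rewrite (@eq_big_nat _ _ _ 0 n _ (fun k => u ^+ j * u ^+ k)); last first.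
  move=> k kn; have -> : (k.+1 == n.+1) = false by lia.
  by rewrite mul1r /pow addSn /= -exprD addnC.
rewrite -mulr_sumr mulrCA geom_sum /pow /side_closed /pow addSn /= exprD; ring.
Qed.

Lemma insideE n : (0 < n)%N -> v ^+ 2 * inside p q n pow = inside_closed n.
Proof.
case: n => // n _; rewrite /inside big_ord_recl /= subn0 expr1 mulrDr expr2.
rewrite -[v * v * _]mulrA [v * (p * _)]mulrCA sideE //= mul1r.
rewrite (eq_bigr (fun c : 'I_n => side q 0 (n - c) pow)); last first.
  by move=> c _; rewrite /= mul1r /bump add1n subSS.
rewrite (reindex_inj rev_ord_inj) /=.
rewrite (eq_bigr (fun c : 'I_n => side q 0 c.+1 pow)); last first.
  by move=> c _; rewrite subKn.
suff -> : v * v * (\sum_(c < n) side q 0 c.+1 pow) =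
  v * (q * (1 - u ^+ n) + n%:R) - (1 - u ^+ n).
  by rewrite /side_closed /inside_closed /pow /=; ring.
elim: n => [|n IHn]; first by rewrite big_ord0 /=; ring.
rewrite big_ord_recr mulrDr IHn -mulrA sideE //= /side_closed /pow /= exprS /v.
by rewrite -natr1; ring.
Qed.

Lemma colsumD N m l r S w w' :
  colsum p q N m l r S (fun n => w n + w' n) =
  colsum p q N m l r S w + colsum p q N m l r S w'.
Proof. by rewrite -big_split; apply: eq_bigr => s _; rewrite mulrDr. Qed.

Lemma colsumZ N m l r S a w :
  colsum p q N m l r S (fun n => a * w n) = a * colsum p q N m l r S w.
Proof. by rewrite mulr_sumr; apply: eq_bigr => s _; rewrite mulrCA. Qed.

Definition colseries m S w : fps K := Fps (fun h => colsum p q h m 0 h S w).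
(** As a series in y this is uy/(1 - uy): an overhang by j >= 1 adds j rows and a factor u^j. *)
Definition geo : fps K := Fps (fun j => if j is 0 then 0 else u ^+ j).

Lemma colseriesD m S w w' :
  colseries m S (fun n => w n + w' n) = colseries m S w + colseries m S w'.
Proof. by apply: fpsP => h /=; rewrite colsumD. Qed.

Lemma fpsC_coefM (a : K) (f : fps K) n : (fpsC a * f) n = a * f n.
Proof.
by rewrite fps_coefM big_ord_recl /= subn0 big1 ?addr0 // => i _; rewrite mul0r.
Qed.

Lemma colseriesZ m S a w :
  colseries m S (fun n => a * w n) = fpsC a * colseries m S w.
Proof. by apply: fpsP => h; rewrite fpsC_coefM /= colsumZ. Qed.

Lemma geo_coefM (f : fps K) h :
  (geo * f) h = \sum_(1 <= i < h.+1) u ^+ i * f (h - i)%N.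
Proof.
rewrite fps_coefM -(big_mkord predT (fun i => geo i * f (h - i)%N)) /=.
rewrite big_nat_recl //= mul0r add0r big_add1 /=.
by apply: eq_big_nat => -[].
Qed.

Lemma geo_coefM_rev (f : fps K) h :
  (geo * f) h = \sum_(0 <= r < h) u ^+ (h - r) * f r.
Proof.
rewrite geo_coefM big_add1 /= big_nat_rev /=; apply: eq_big_nat => r rh.
by rewrite add0n subnS; congr (u ^+ _ * f _); lia.
Qed.

(** After translating the tail down to height 0, the sum over an overhang is a Cauchy product with
    [geo]; overhangs at both ends give [geo ^+ 2]. *)
Lemma colseries_step m :
  fpsC v ^+ 2 * colseries m.+2 predT pow =
    colseries m.+1 predT inside_closed
  + fpsC v * geo * (colseries m.+1 top_first (side_closed p)
                    + colseries m.+1 bottom_first (side_closed q))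
  + fpsC v ^+ 2 * geo ^+ 2 * colseries m.+1 (predI top_first bottom_first) pow.
Proof.
have ts l s : s != [::] -> top_first (shift l s) = top_first s.
  exact: top_first_shift.
have bs l s : s != [::] -> bottom_first (shift l s) = bottom_first s.
  exact: bottom_first_shift.
apply: fpsP => h; rewrite -rmorphXn [geo ^+ 2]expr2 -!mulrA mulrDr.
rewrite !(fps_coefD, fpsC_coefM) [LHS]/= colsum_step.
rewrite !mulrDr -!addrA; congr (_ + _).
  by rewrite -colsumZ; apply: colsum_eq => n; exact: insideE.
congr (_ + (_ + _)).
- rewrite geo_coefM_rev expr2 -mulrA; congr (v * _); rewrite mulr_sumr.
  apply: eq_big_nat => r /andP[_ rh].
  rewrite colsum_shift ?(ltnW rh) // ?subn0 -?colsumZ; last by move=> *; exact: ts.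
  by apply: colsum_eq => n; exact: sideE.
- rewrite geo_coefM expr2 -mulrA; congr (v * _); rewrite mulr_sumr.
  apply: eq_big_nat => l /andP[l0 lh].
  rewrite colsum_shift // -?colsumZ; last by move=> *; exact: bs.
  by apply: colsum_eq => n; exact: sideE.
congr (_ * _); rewrite geo_coefM; apply: eq_big_nat => l /andP[l0 lh].
(* The terms with r < l vanish, as [lo s < hi s] for convex s; the others are shifted down by l. *)
rewrite geo_coefM_rev mulr_sumr (big_cat_nat (n := l)) //= big_nat big1 ?add0r.
  rewrite -[l in LHS]add0n big_addn; apply: eq_big_nat => r /andP[_ rh].
  rewrite add0n colsum_shift; first last.
  - by move=> s s0; rewrite /= ts ?bs.
  - by lia.
  rewrite addnK -!colsumZ; apply: colsum_eq => n n0; rewrite mulrA -exprD -exprD.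
  by congr (u ^+ _); lia.
move=> r /andP[_ rl]; rewrite /colsum big1 // => s.
by move=> /andP[/and3P[/ltn_lo_hi + /eqP los /eqP his] _]; rewrite los his; lia.
Qed.

Lemma colsum_size0 h l r S w : colsum p q h 0 l r S w = 0.
Proof. by rewrite /colsum -[col_seqs h 0]/[:: [::]] big_cons big_nil. Qed.

Lemma colseries0 S w : colseries 0 S w = 0.
Proof. by apply: fpsP => h; exact: colsum_size0. Qed.

Lemma fpsX_coefM (f : fps K) n : (fpsX K * f) n = if n is n'.+1 then f n' else 0.
Proof.
rewrite fps_coefM; case: n => [|n]; first by rewrite big_ord1 mul0r.
rewrite big_ord_recl big_ord_recl /= mul0r add0r mul1r subSS subn0.
by rewrite big1 ?addr0 // => i _; rewrite mul0r.
Qed.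

Lemma colseries1 : (1 - fpsC u * fpsX K) * colseries 1 predT pow = fpsX K.
Proof.
have sum1 h : colseries 1 predT pow h = if h is h'.+1 then u ^+ h' else 0.
  case: h => [|h] /=; rewrite /colsum.
    rewrite big1 // => s /andP[/and3P[/ltn_lo_hi + /eqP los /eqP his] _].
    by rewrite los his.
  rewrite -big_filter (perm_big [:: [:: (0, h.+1)%N]]).
    by rewrite big_seq1 /weight /= !expr0 !mul1r.
  apply: uniq_perm; [exact/filter_uniq/uniq_col_seqs|by []|] => s.
  rewrite mem_filter mem_col_seqs andbT; case: s => [|[b t] [|d s]] //=.
    rewrite /boxed /= maxn0 mem_columns /= !andbT mem_seq1 eqseq_cons /= andbT.
    by rewrite xpair_eqE; lia.
  by rewrite mem_seq1 eqseq_cons !andbF.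
rewrite mulrBl mul1r -mulrA; apply: fpsP => h.
rewrite fps_coefB fpsC_coefM fpsX_coefM sum1.
case: h => [|h]; first by rewrite mulr0 subr0.
by rewrite sum1; case: h => [|h]; rewrite ?mulr0 ?subr0 // -exprS subrr.
Qed.

Lemma geoE : (1 - fpsC u * fpsX K) * geo = fpsC u * fpsX K.
Proof.
rewrite mulrBl mul1r -mulrA; apply: fpsP => h.
rewrite fps_coefB !fpsC_coefM fpsX_coefM /=.
case: h => [|[|h]] /=; first by rewrite mulr0 subr0.
  by rewrite mulr0 subr0 mulr1.
by rewrite -exprS subrr mulr0.
Qed.
End Recurrence.

(** * The functional equation and its kernel *)

Lemma fps_coef_sum (R : zmodType) (I : Type) (r : seq I) (P : pred I)
    (F : I -> fps R) n :
  (\sum_(i <- r | P i) F i) n = \sum_(i <- r | P i) F i n.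
Proof. by elim/big_rec2: _ => // i f g _ <-. Qed.

(** * Formal sums over the number of columns *)

Section PowerSum.
Variables (R : comNzRingType) (x : fps R).
Hypothesis x0 : x 0%N = 0.

Lemma coef_expM_lt m (f : fps R) n : (n < m)%N -> (x ^+ m * f) n = 0.
Proof.
elim: m n => // m IHm n nm; rewrite exprS -mulrA fps_coefM big_ord_recl x0 mul0r.
rewrite add0r big1 // => i _; rewrite IHm ?mulr0 //= /bump /=.
by have := ltn_ord i; lia.
Qed.

Lemma fps_sum_coef (F : nat -> fps R) n N : (n <= N)%N ->
  fps_sum (fun m => x ^+ m * F m) n = \sum_(m < N.+1) (x ^+ m * F m) n.
Proof.
move=> nN; rewrite -[LHS]/(\sum_(m < n.+1) (x ^+ m * F m) n).
rewrite (big_ord_widen N.+1 (fun m => (x ^+ m * F m) n)) //.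
rewrite big_mkcond; apply: eq_bigr => m _; case: ltnP => // nm.
by rewrite coef_expM_lt.
Qed.

(** The outer variable is y. As x has no constant term, x^m has order at least m, and the truncated
    [fps_sum] is the full sum of the x^m F_m. *)
Definition xsum (F : nat -> fps (fps R)) : fps (fps R) :=
  Fps (fun h => fps_sum (fun m => x ^+ m * F m h)).

Lemma xsum_coef F h n : xsum F h n = \sum_(m < n.+1) (x ^+ m * F m h) n.
Proof. by []. Qed.

Lemma eq_xsum F F' : F =1 F' -> xsum F = xsum F'.
Proof.
move=> FF; apply: fpsP => h; apply: fpsP => n; rewrite !xsum_coef.
by apply: eq_bigr => m _; rewrite FF.
Qed.

Lemma xsumD F F' : xsum (fun m => F m + F' m) = xsum F + xsum F'.
Proof.
apply: fpsP => h; apply: fpsP => n; rewrite !fps_coefD !xsum_coef -big_split.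
by apply: eq_bigr => m _; rewrite fps_coefD mulrDr.
Qed.

(** Both products are convolutions; [fps_sum_coef] brings all truncations to the common bound n,
    after which finite sums are exchanged. *)
Lemma xsumM (f : fps (fps R)) F : xsum (fun m => f * F m) = f * xsum F.
Proof.
apply: fpsP => h; rewrite fps_coefM; apply: fpsP => n; rewrite fps_coef_sum.
rewrite xsum_coef; under eq_bigr do rewrite [(f * _) h]fps_coefM mulr_sumr fps_coef_sum.
rewrite exchange_big; apply: eq_bigr => i _.
under eq_bigr do rewrite mulrCA fps_coefM.
rewrite exchange_big fps_coefM; apply: eq_bigr => j _.
by rewrite -mulr_sumr [in RHS](@fps_sum_coef _ _ n) // leq_subr.
Qed.

Lemma xsum_recl F : xsum F = F 0%N + fpsC x * xsum (fun m => F m.+1).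
Proof.
apply: fpsP => h; rewrite fps_coefD fpsC_coefM; apply: fpsP => n.
rewrite fps_coefD xsum_coef big_ord_recl expr0 mul1r; congr (_ + _).
rewrite fps_coefM big_ord_recl x0 mul0r add0r.
case: n => [|n]; first by rewrite !big_ord0.
rewrite (eq_bigr (fun i : 'I_n.+1 => \sum_(j < n.+1)
    x j.+1 * (x ^+ i * F i.+1 h) (n - j)%N)) => [|i _]; last first.
  rewrite exprS -mulrA fps_coefM big_ord_recl x0 mul0r add0r.
  by apply: eq_bigr.
rewrite exchange_big; apply: eq_bigr => j _; rewrite -mulr_sumr; congr (_ * _).
by rewrite -[xsum _ _ _]/(fps_sum _ (n - j)%N) (@fps_sum_coef _ _ n) // leq_subr.
Qed.

End PowerSum.

(** * The functional equation *)

Section FunctionalEquation.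
Variables (R : comNzRingType) (x p q : fps R).
Hypothesis x0 : x 0%N = 0.
Implicit Types (S : pred (seq column)) (w : nat -> fps R) (u a : fps R).

(** With w = [pow u] this is the generating function at u; w = [pow 1] gives its value at u = 1, and
    w n = n - 1 its u-derivative there. *)
Definition shapesum S w := xsum x (fun m => colseries p q m S w).

Lemma eq_shapesum S w w' :
  (forall n, (0 < n)%N -> w n = w' n) -> shapesum S w = shapesum S w'.
Proof.
move=> ww; apply: eq_xsum => m; apply: fpsP => h; exact: colsum_eq.
Qed.

Lemma shapesumD S w w' :
  shapesum S (fun n => w n + w' n) = shapesum S w + shapesum S w'.
Proof. by rewrite -xsumD; apply: eq_xsum => m; exact: colseriesD. Qed.

Lemma shapesumZ S a w :
  shapesum S (fun n => a * w n) = fpsC a * shapesum S w.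
Proof. by rewrite -xsumM //; apply: eq_xsum => m; exact: colseriesZ. Qed.

Lemma shapesum_side S u z : shapesum S (side_closed u z) =
  (fpsC (1 - u) * fpsC z - 1) * shapesum S (pow u) + shapesum S (pow 1).
Proof.
rewrite (@eq_shapesum _ _ (fun n => ((1 - u) * z - 1) * pow u n + pow 1 n)).
  by rewrite shapesumD shapesumZ rmorphB rmorphM rmorph1.
by move=> n _; rewrite /side_closed /pow expr1n; ring.
Qed.

Lemma shapesum_inside S u : shapesum S (inside_closed p q u) =
  (fpsC (1 - u) ^+ 2 * fpsC p * fpsC q - (fpsC p + fpsC q) * fpsC (1 - u) + 1)
    * shapesum S (pow u)
  + ((fpsC p + fpsC q) * fpsC (1 - u) - 1) * shapesum S (pow 1)
  + fpsC (1 - u) * shapesum S (fun n => n.-1%:R).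
Proof.
rewrite (@eq_shapesum _ _ (fun n =>
  ((1 - u) ^+ 2 * p * q - (p + q) * (1 - u) + 1) * pow u n
  + ((p + q) * (1 - u) - 1) * pow 1 n + (1 - u) * n.-1%:R)).
  by rewrite !shapesumD !shapesumZ !(rmorphB, rmorphD, rmorphM, rmorphXn, rmorph1).
by move=> n _; rewrite /inside_closed /pow expr1n; ring.
Qed.

Lemma functional_equation u :
  fpsC (1 - u) ^+ 2 * shapesum predT (pow u) =
  fpsC x * (fpsC (1 - u) ^+ 2 * colseries p q 1 predT (pow u)
    + shapesum predT (inside_closed p q u)
    + fpsC (1 - u) * geo u * (shapesum top_first (side_closed u p)
                              + shapesum bottom_first (side_closed u q))
    + fpsC (1 - u) ^+ 2 * geo u ^+ 2
      * shapesum (predI top_first bottom_first) (pow u)).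
Proof.
rewrite {1}/shapesum xsum_recl // colseries0 add0r mulrCA; congr (_ * _).
(* [colseries_step] starts at two columns, so the one-column term is split off as well. *)
rewrite -xsumM // (xsum_recl x0); rewrite -!addrA; congr (_ + _).
rewrite /shapesum -!xsumD -!xsumM // -!xsumD [RHS]xsum_recl //.
rewrite !colseries0 !(addr0, mulr0) add0r [LHS]xsumM //; congr (_ * _).
by apply: eq_xsum => m; rewrite colseries_step addrA.
Qed.

End FunctionalEquation.

(** * The generating functions as sums over sequences *)

Section Genfun.
Implicit Types (u : Qpq_x) (p q : Qpq).

Lemma genfunE (P : forall m h, pred {set 'I_m * 'I_h}) S u p q :
    (forall m h (A : {set 'I_m * 'I_h}), P m h A = CP A && S (cols A)) ->
  genfun P u p q = shapesum x_ (fpsC p) (fpsC q) S (pow u).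
Proof.
move=> PS; apply: fpsP => h; congr fps_sum; apply/boolp.funext => m.
congr (_ * _); rewrite /= /colsum -big_filter_cond.
rewrite -(perm_big _ (perm_cols m h)) big_map big_enum_cond /=.
apply: eq_big => [A|A]; first by rewrite PS.
rewrite PS => /andP[cA _]; rewrite statBE statUE stataE // /weight.
by rewrite rmorphM !rmorphXn.
Qed.

(** This is how G^t with p and q exchanged enters: it is the series of CP^b with p and q in their
    usual roles. *)
Lemma genfun_flip u p q : genfun CPt u q p =
  shapesum x_ (fpsC p) (fpsC q) bottom_first (pow u).
Proof.
rewrite (genfunE _ _ _ (@CPtE)); apply: eq_xsum => m; apply: fpsP => h.
by rewrite /= colsum_flip.
Qed.

End Genfun.

(* At a root of the kernel the unknown series [shapesum predT (pow u)] drops *)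
(* out of the functional equation.                                            *)
Lemma kernel_equation (R : idomainType) (x p q u : fps R) :
    x != 0 -> x 0%N = 0 ->
    (1 - u) ^+ 2 = x * ((1 - u) ^+ 2 * p * q - (p + q) * (1 - u) + 1) ->
  let v := 1 - fpsC u in
  let P := fpsC p in
  let Q := fpsC q in
  v ^+ 2 * colseries p q 1 predT (pow u)
  + ((P + Q) * v - 1) * shapesum x p q predT (pow 1)
  + v * shapesum x p q predT (fun n => n.-1%:R)
  + v * geo u * ((v * P - 1) * shapesum x p q top_first (pow u)
                 + shapesum x p q top_first (pow 1)
                 + ((v * Q - 1) * shapesum x p q bottom_first (pow u)
                    + shapesum x p q bottom_first (pow 1)))
  + v ^+ 2 * geo u ^+ 2
    * shapesum x p q (predI top_first bottom_first) (pow u) = 0.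
Proof.
move=> xn0 x0 ker v P Q; have X0 : fpsC x != 0.
  by apply/eqP => /(congr1 (fun f : fps (fps R) => f 0%N)) /eqP;
    rewrite [X in X == _]/= (negbTE xn0).
have vE : fpsC (1 - u) = v by rewrite rmorphB rmorph1.
have {}ker : v ^+ 2 = fpsC x * (v ^+ 2 * P * Q - (P + Q) * v + 1).
  rewrite -vE; move: (1 - u) ker => w /(congr1 (@fpsC _)).
  by rewrite !(rmorphXn, rmorphD, rmorphN, rmorphM, rmorph1).
have := functional_equation p q x0 u.
rewrite shapesum_inside // !shapesum_side // vE -/P -/Q.
move: (shapesum _ _ _ _ _) (shapesum _ _ _ _ _) (shapesum _ _ _ _ _) => a b c.
move: (shapesum _ _ _ _ _) (shapesum _ _ _ _ _) (shapesum _ _ _ _ _) => d e f.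
move: (shapesum _ _ _ _ _) (colseries _ _ _ _ _) (geo u) => g z o.
(* Replacing v^2 on the left by the kernel relation makes both sides multiples of x with the same
   coefficient of G(u); their difference divided by x is the claim. *)
move=> /eqP; rewrite {1}ker -subr_eq0 => /eqP E; apply: (mulfI X0).
by rewrite mulr0 -oppr0 -[in RHS]E; ring.
Qed.

(** * Roots of the kernel and elimination of the derivative *)

Lemma natf_neq0 (n : nat) : (n.+1%:R : Qpq) != 0.
Proof. by apply: contraTneq (unit_nat_Qpq n) => ->; rewrite unitr0. Qed.

Lemma natf_x_neq0 (n : nat) : (n.+1%:R : Qpq_x) != 0.
Proof.
by rewrite -(rmorph_nat (@fpsC Qpq)); apply/eqP => /(congr1 (fun f : Qpq_x => f 0%N))
  /eqP; rewrite /= (negbTE (natf_neq0 n)).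
Qed.

Lemma fpsX_neq0 (R : comNzRingType) : fpsX R != 0.
Proof.
apply/eqP => /(congr1 (fun f : fps R => f 1%N)) /eqP.
by rewrite /= oner_eq0.
Qed.

Lemma x_neq0 : x_ != 0.
Proof. by rewrite expf_neq0 // fpsX_neq0. Qed.

Definition is_kernel_root (u : Qpq_x) := (1 - u) ^+ 2 =
  x_ * ((1 - u) ^+ 2 * fpsC p_ * fpsC q_ - (fpsC p_ + fpsC q_) * (1 - u) + 1).

(** In w = u - 1 the relation is (1 - pqx) w^2 - (p+q) x w - x = 0, with discriminant (p-q)^2 x^2 +
    4x. Leaving the square root d arbitrary covers both signs. *)
Lemma kernel_root (d : Qpq_x) :
    d ^+ 2 = fpsC (p_ - q_) ^+ 2 * x_ ^+ 2 + 4%:R * x_ ->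
  is_kernel_root
    (1 + (fpsC (p_ + q_) * x_ + d) / (2%:R * (1 - fpsC (p_ * q_) * x_))).
Proof.
rewrite /is_kernel_root !(rmorphB, rmorphD, rmorphM) /=.
have := unit_u_denominator; rewrite rmorphM /=.
move: (fpsC p_) (fpsC q_) x_ => p q x cU dE.
set c := 2%:R * _ in cU *; set w := (_ + d) / c.
have wE : c * w = (p + q) * x + d by rewrite /w mulrC divrK.
have c0 : c != 0 by apply: contraTneq cU => ->; rewrite unitr0.
have E : (c * w - (p + q) * x) ^+ 2 - ((p - q) ^+ 2 * x ^+ 2 + 4%:R * x) = 0.
  by rewrite wE [_ + d]addrC addrK dE subrr.
(* Multiplication by 2c = 4(1 - pqx) completes the square and yields E. *)
clearbody w; apply: (mulfI c0); apply: (mulfI (natf_x_neq0 1)).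
by apply/eqP; rewrite -subr_eq0 -E /c; apply/eqP; ring.
Qed.

(** Here g and d stand for the unknowns G(1) and G'(1), z for the one-column series y/(1 - yu), and
    e for [geo u]. *)
Lemma elimination (F : fieldType)
    (p q y up um g d zp zm ep em tp tm tp' tm' t1 t1' btp btm : F) :
    1 - y * up != 0 -> 1 - y * um != 0 -> up - um != 0 ->
    (1 - up * y) * zp = y -> (1 - um * y) * zm = y ->
    (1 - up * y) * ep = up * y -> (1 - um * y) * em = um * y ->
    (1 - up) ^+ 2 * zp + ((p + q) * (1 - up) - 1) * g + (1 - up) * d
    + (1 - up) * ep * (((1 - up) * p - 1) * tp + t1 + (((1 - up) * q - 1) * tp' + t1'))
    + (1 - up) ^+ 2 * ep ^+ 2 * btp = 0 ->
    (1 - um) ^+ 2 * zm + ((p + q) * (1 - um) - 1) * g + (1 - um) * d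
    + (1 - um) * em * (((1 - um) * p - 1) * tm + t1 + (((1 - um) * q - 1) * tm' + t1'))
    + (1 - um) ^+ 2 * em ^+ 2 * btm = 0 ->
  g =
    y * (y - 1) * (1 - up) * (1 - um) / ((1 - y * up) * (1 - y * um))
  + y ^+ 2 * (1 - up) * (1 - um) / (up - um)
    * (up ^+ 2 * (1 - up) * btp / (1 - y * up) ^+ 2
       - um ^+ 2 * (1 - um) * btm / (1 - y * um) ^+ 2)
  - y * up * (1 - up) * (1 - um) / ((up - um) * (1 - y * up))
    * ((1 - p * (1 - up)) * tp + (1 - q * (1 - up)) * tp')
  + y * um * (1 - up) * (1 - um) / ((up - um) * (1 - y * um))
    * ((1 - p * (1 - um)) * tm + (1 - q * (1 - um)) * tm')
  + y * (1 - up) * (1 - um) / ((1 - y * up) * (1 - y * um)) * (t1 + t1').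
Proof.
move=> yp ym u0; rewrite ![_ * y]mulrC => zpE zmE epE emE Ep Em.
have {}zpE : zp = y / (1 - y * up) by apply: (mulfI yp); rewrite zpE; field.
have {}zmE : zm = y / (1 - y * um) by apply: (mulfI ym); rewrite zmE; field.
have {}epE : ep = y * up / (1 - y * up) by apply: (mulfI yp); rewrite epE; field.
have {}emE : em = y * um / (1 - y * um) by apply: (mulfI ym); rewrite emE; field.
(* Each equation reads (1-u) B + ((p+q)(1-u) - 1) g + (1-u) d = 0. Cross-multiplying by 1 - um and 1
   - up and subtracting removes d and the terms in (p+q) g. *)
pose B u z e t t' bt := (1 - u) * z
  + e * (((1 - u) * p - 1) * t + t1 + (((1 - u) * q - 1) * t' + t1'))
  + (1 - u) * e ^+ 2 * bt.
have gE : g * (up - um) =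
    (1 - up) * (1 - um) * (B up zp ep tp tp' btp - B um zm em tm tm' btm).
  have := congr2 (fun a b => (1 - um) * a - (1 - up) * b) Ep Em.
  rewrite !mulr0 subr0 => E; apply/eqP; rewrite -subr_eq0 -oppr_eq0; apply/eqP.
  by rewrite -[RHS]E /B; ring.
have {gE} -> : g = (1 - up) * (1 - um) / (up - um)
    * (B up zp ep tp tp' btp - B um zm em tm tm' btm).
  by apply: (mulIf u0); rewrite gE [RHS]mulrAC divfK.
(* The factor up - um cancels because (1-up)(1-y um) - (1-um)(1-y up) = (y-1)(up-um); in the next
   identity the numerator is y (up-um). *)
have -> : y * (y - 1) * (1 - up) * (1 - um) / ((1 - y * up) * (1 - y * um))
    = (1 - up) * (1 - um) / (up - um) * ((1 - up) * zp - (1 - um) * zm).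
  by rewrite zpE zmE; field; rewrite u0 ym yp.
have -> : y * (1 - up) * (1 - um) / ((1 - y * up) * (1 - y * um))
    = (1 - up) * (1 - um) / (up - um) * (ep - em).
  by rewrite epE emE; field; rewrite u0 ym yp.
rewrite /B epE emE -!exprVn !invfM.
(* No inverse has to cancel any more, so the inverses become indeterminates. *)
move: (1 - y * up)^-1 (1 - y * um)^-1 (up - um)^-1 {yp ym u0 zpE zmE epE emE Ep Em} => a b c.
move: (1 - up) (1 - um) => vp vm; ring.
Qed.

Lemma one_minus_y_neq0 u : 1 - frac_of_xy y_ * frac_of_x u != 0.
Proof.
rewrite /frac_of_xy /frac_of_x -tofrac1 -tofracM -tofracB tofrac_eq0.
apply/eqP => /(congr1 (fun f : Qpq_xy => f 0%N)) /eqP.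
by rewrite fps_coefB fps_coefM big_ord1 mul0r subr0 oner_eq0.
Qed.

(** Its square is x ((p-q)^2 x + 4), and the second factor has constant coefficient 4. *)
Lemma sqrt_disc_neq0 : sqrt_disc != 0.
Proof.
apply/eqP => d0; have := sqr_sqrt_disc; rewrite d0 expr0n /= expr2 mulrA -mulrDl.
move=> /esym/eqP; rewrite mulf_eq0 (negbTE x_neq0) orbF => /eqP.
move=> /(congr1 (fun f : Qpq_x => f 0%N)) /eqP.
rewrite fps_coefD fps_coefM big_ord1 x_coef0 mulr0 add0r.
by rewrite -(rmorph_nat (@fpsC Qpq)) /= (negbTE (natf_neq0 3)).
Qed.

Lemma u_plus_minus_neq0 : frac_of_x u_plus - frac_of_x u_minus != 0.
Proof.
have uE : u_plus - u_minus =
    sqrt_disc * 2%:R / (2%:R * (1 - fpsC (p_ * q_) * x_)).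
  rewrite /u_plus /u_minus; move: (_ * x_) (_^-1) sqrt_disc => s c d; ring.
have u0 : u_plus - u_minus != 0.
  rewrite uE; apply: mulf_neq0.
    exact: mulf_neq0 sqrt_disc_neq0 (natf_x_neq0 1).
  rewrite invr_eq0; apply: contraTneq unit_u_denominator => ->.
  by rewrite unitr0.
rewrite /frac_of_x -tofracB tofrac_eq0 -rmorphB; apply: contraNneq u0.
by move=> /(congr1 (fun f : Qpq_xy => f 0%N)) /= ->.
Qed.

(** With variables in place of the concrete series, the passage to the fraction field is pure
    rewriting by morphism rules. *)
Lemma tofrac_kernel (D : idomainType) (p q u z g d e t t1 t' t1' b : D) :
    (1 - u) ^+ 2 * z + ((p + q) * (1 - u) - 1) * g + (1 - u) * d
    + (1 - u) * e * (((1 - u) * p - 1) * t + t1 + (((1 - u) * q - 1) * t' + t1'))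
    + (1 - u) ^+ 2 * e ^+ 2 * b = 0 ->
  let v := 1 - tofrac u in
  v ^+ 2 * tofrac z + ((tofrac p + tofrac q) * v - 1) * tofrac g + v * tofrac d
  + v * tofrac e
    * ((v * tofrac p - 1) * tofrac t + tofrac t1
       + ((v * tofrac q - 1) * tofrac t' + tofrac t1'))
  + v ^+ 2 * tofrac e ^+ 2 * tofrac b = 0.
Proof.
move=> /(congr1 (@tofrac D)).
by rewrite !(tofracXn, tofracD, tofracN, tofracM, tofrac1, tofrac0).
Qed.

Lemma frac_kernel_equation u : is_kernel_root u ->
  let p := frac_of_pq p_ in
  let q := frac_of_pq q_ in
  let v := 1 - frac_of_x u in
  let Gt := fun u p' q' => frac_of_xy (genfun CPt u p' q') in
  let g := frac_of_xy (geo u) in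
  v ^+ 2 * frac_of_xy (colseries (fpsC p_) (fpsC q_) 1 predT (pow u))
  + ((p + q) * v - 1) * frac_of_xy (genfun CP 1 p_ q_)
  + v * frac_of_xy (shapesum x_ (fpsC p_) (fpsC q_) predT (fun n => n.-1%:R))
  + v * g * ((v * p - 1) * Gt u p_ q_ + Gt 1 p_ q_
             + ((v * q - 1) * Gt u q_ p_ + Gt 1 q_ p_))
  + v ^+ 2 * g ^+ 2 * frac_of_xy (genfun CPbt u p_ q_) = 0.
Proof.
move=> ker; rewrite /= ![genfun CPt _ q_ p_]genfun_flip.
rewrite (genfunE (S := predT) _ _ _ (fun m h A => esym (andbT (CP A)))).
rewrite !(genfunE _ _ _ CPtE) (genfunE _ _ _ CPbtE).
exact: tofrac_kernel (kernel_equation x_neq0 x_coef0 ker).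
Qed.

Lemma tofrac_1BM (D : idomainType) (a b c d : D) :
  (1 - a * b) * c = d -> (1 - tofrac a * tofrac b) * tofrac c = tofrac d.
Proof. by move=> <-; rewrite tofracM tofracB tofracM tofrac1. Qed.

Lemma frac_colseries1 (p q u : Qpq_x) :
  (1 - frac_of_x u * frac_of_xy y_) * frac_of_xy (colseries p q 1 predT (pow u))
  = frac_of_xy y_.
Proof. exact: tofrac_1BM (colseries1 p q u). Qed.

Lemma frac_geo (u : Qpq_x) :
  (1 - frac_of_x u * frac_of_xy y_) * frac_of_xy (geo u)
  = frac_of_x u * frac_of_xy y_.
Proof. by rewrite [LHS](tofrac_1BM (geoE u)) tofracM. Qed.

Theorem theorem3p2 :
  let p := frac_of_pq p_ in
  let q := frac_of_pq q_ in
  let y := frac_of_xy y_ in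
  let up := frac_of_x u_plus in
  let um := frac_of_x u_minus in
  let G := fun u p' q' => frac_of_xy (genfun CP u p' q') in
  let Gt := fun u p' q' => frac_of_xy (genfun CPt u p' q') in
  let Gbt := fun u p' q' => frac_of_xy (genfun CPbt u p' q') in
  G 1 p_ q_ =
    y * (y - 1) * (1 - up) * (1 - um) / ((1 - y * up) * (1 - y * um))
  + y ^+ 2 * (1 - up) * (1 - um) / (up - um)
    * (up ^+ 2 * (1 - up) * Gbt u_plus p_ q_ / (1 - y * up) ^+ 2
       - um ^+ 2 * (1 - um) * Gbt u_minus p_ q_ / (1 - y * um) ^+ 2)
  - y * up * (1 - up) * (1 - um) / ((up - um) * (1 - y * up))
    * ((1 - p * (1 - up)) * Gt u_plus p_ q_
       + (1 - q * (1 - up)) * Gt u_plus q_ p_)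
  + y * um * (1 - up) * (1 - um) / ((up - um) * (1 - y * um))
    * ((1 - p * (1 - um)) * Gt u_minus p_ q_
       + (1 - q * (1 - um)) * Gt u_minus q_ p_)
  + y * (1 - up) * (1 - um) / ((1 - y * up) * (1 - y * um))
    * (Gt 1 p_ q_ + Gt 1 q_ p_).
Proof.
move=> p q y up um G Gt Gbt.
have kp : is_kernel_root u_plus := kernel_root sqr_sqrt_disc.
have km : is_kernel_root u_minus.
  by apply: kernel_root; rewrite sqrrN; exact: sqr_sqrt_disc.
exact: (elimination (one_minus_y_neq0 _) (one_minus_y_neq0 _) u_plus_minus_neq0
  (frac_colseries1 _ _ _) (frac_colseries1 _ _ _) (frac_geo _) (frac_geo _)
  (frac_kernel_equation kp) (frac_kernel_equation km)).
Qed.
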